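(* For every $a,b\in[0,1]$, every $\alpha_1,\alpha_2\in[0,1)$, and every $C_1,C_2>0$, there exist a threshold $p^*\in[0,1]$ and an optimal policy for the two-site moving-target search problem of the following form: at each search epoch, with $p$ denoting the current posterior probability that the target is at site $1$, search site $2$ whenever $p<p^*$, and search site $1$ whenever $p>p^*$. (At $p=p^*$ the form of the policy imposes no restriction: the policy may select either site there.) Here optimal means that, for every initial belief $p\in[0,1]$, the expected total search cost of the policy equals the infimum $V(p)$ over all policies.
   Context: Model. A target occupies site $1$ or site $2$; the initial belief $p\in[0,1]$ is the probability that it is initially at site $1$. At each epoch $t=1,2,\dots$ (until detection) the searcher chooses a site $i\in\{1,2\}$ and pays $C_i>0$. If the target is at site $i$, the search fails to detect it with probability $\alpha_i$ (and detects it, ending the process, with probability $1-\alpha_i$); a search of the wrong site fails. After an unsuccessful search the target moves according to the Markov transition matrix $M=\begin{pmatrix}a&1-a\\1-b&b\end{pmatrix}$, so $a$ and $b$ are the probabilities of remaining at sites $1$ and $2$. The searcher observes only its own decisions and whether each search succeeded. Policies may be history dependent and randomised. The total cost is the sum of the search costs up to and including detection; a sample path on which detection never occurs has cost $+\infty$. $V(p)\in[0,\infty]$ is the infimum over all policies of the expected total cost from initial belief $p$. Belief updates. With current posterior belief $p$ (probability of site $1$ given the history), a search of site $i$ is unsuccessful with probability $q_1(p)=\alpha_1p+1-p$, $q_2(p)=p+\alpha_2(1-p)$, and, given failure and the subsequent movement, the next belief is $$F_1(p)=\frac{\alpha_1ap+(1-b)(1-p)}{q_1(p)},\qquad F_2(p)=\frac{ap+\alpha_2(1-b)(1-p)}{q_2(p)}$$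 (irrelevant when $q_i(p)=0$). *)

(* Defs.v *)
From HB Require Import structures.
From mathcomp Require Import all_boot all_order all_algebra.
From mathcomp Require Import all_classical all_reals all_analysis.

Set Implicit Arguments.
Unset Strict Implicit.
Unset Printing Implicit Defensive.

Import Order.TTheory GRing.Theory Num.Theory.

Local Open Scope classical_set_scope.
Local Open Scope ring_scope.

(* Sites are booleans: [true] is site 1 and [false] is site 2. *)
Notation site := bool (only parsing).

Record search_model (R : realType) := SearchModel {
  stay1 : R;      (* a *)
  stay2 : R;      (* b *)
  overlook1 : R;  (* alpha_1 *)
  overlook2 : R;  (* alpha_2 *)
  cost1 : R;      (* C_1 *)
  cost2 : R       (* C_2 *)
}.

Definition search_cost (R : realType) (m : search_model R) (i : site) : R :=
  if i then cost1 m else cost2 m.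

(* Probability that a search of site [i] fails when the target is at [x]. *)
Definition miss (R : realType) (m : search_model R) (i x : site) : R :=
  if i == x then (if i then overlook1 m else overlook2 m) else 1.

Definition bernoulli_site (R : realType) (p : R) (x : site) : R :=
  if x then p else 1 - p.

(* Row [x] of the transition matrix M. *)
Definition move (R : realType) (m : search_model R) (x : site) : site -> R :=
  bernoulli_site (if x then stay1 m else 1 - stay2 m).

(* While the target is undetected, the searcher has seen only failures, so the
   information at an epoch is the (known) initial belief together with the
   chronological list of the sites searched so far.  A history-dependent
   randomised policy maps it to the probability of searching site 1 next. *)
Definition policy (R : realType) := R -> seq site -> R.

Definition is_policy (R : realType) (pi : policy R) : Prop :=
  forall (p : R) (h : seq site), 0 <= p <= 1 -> 0 <= pi p h <= 1.

(* A sample path ending in detection lists, epoch by epoch, the target's site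
   and the searched site; its last entry is the epoch of detection. *)
Definition detected_path := seq (site * site).

(* Probability of exactly the detected path [w], when the sites in [h] were
   already searched, the current target site has law [nu], and the searcher
   uses the randomised decision rule [d]. *)
Fixpoint detected_prob (R : realType) (m : search_model R)
    (d : seq site -> R) (h : seq site) (nu : site -> R)
    (w : detected_path) : R :=
  if w is (x, i) :: w' then
    nu x * bernoulli_site (d h) i *
    (if w' is [::] then 1 - miss m i x
     else miss m i x * detected_prob m d (rcons h i) (move m x) w')
  else 0.

(* [None] stands for the event that the target is never detected. *)
Definition sample_path := option detected_path.

Definition path_prob (R : realType) (m : search_model R) (pi : policy R)
    (p : R) (w : sample_path) : \bar R :=
  let detected (s : detected_path) : \bar R :=
    (detected_prob m (pi p) [::] (bernoulli_site p) s)%:E in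
  if w is Some s then detected s
  else (1 - \esum_(s in [set: detected_path]) detected s)%E.

Definition path_cost (R : realType) (m : search_model R)
    (w : sample_path) : \bar R :=
  if w is Some s then (\sum_(e <- s) search_cost m e.2)%:E else +oo%E.

(* Recall that 0 * +oo = 0 in the extended reals. *)
Definition expected_cost (R : realType) (m : search_model R) (pi : policy R)
    (p : R) : \bar R :=
  (\esum_(w in [set: sample_path]) (path_prob m pi p w * path_cost m w))%E.

Definition value (R : realType) (m : search_model R) (p : R) : \bar R :=
  ereal_inf [set expected_cost m pi p | pi in [set pi | is_policy pi]].

Definition optimal (R : realType) (m : search_model R) (pi : policy R) : Prop :=
  is_policy pi /\
  forall p : R, 0 <= p <= 1 -> expected_cost m pi p = value m p.

(* q_i(p) *)
Definition fail_prob (R : realType) (m : search_model R) (i : site) (p : R) : R :=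
  if i then overlook1 m * p + (1 - p) else p + overlook2 m * (1 - p).

(* F_i(p) *)
Definition next_belief (R : realType) (m : search_model R) (i : site) (p : R) : R :=
  (if i then overlook1 m * stay1 m * p + (1 - stay2 m) * (1 - p)
   else stay1 m * p + overlook2 m * (1 - stay2 m) * (1 - p)) / fail_prob m i p.

Fixpoint posterior (R : realType) (m : search_model R) (p : R)
    (h : seq site) : R :=
  if h is i :: h' then posterior m (next_belief m i p) h' else p.

(* The searches in [h] can all fail; otherwise [posterior m p h] may involve a
   division by zero and is meaningless. *)
Fixpoint possible_history (R : realType) (m : search_model R) (p : R)
    (h : seq site) : Prop :=
  if h is i :: h' then
    0 < fail_prob m i p /\ possible_history m (next_belief m i p) h'
  else True.

Definition threshold_policy (R : realType) (m : search_model R) (pstar : R)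
    (pi : policy R) : Prop :=
  forall (p : R) (h : seq site), 0 <= p <= 1 -> possible_history m p h ->
    (posterior m p h < pstar -> pi p h = 0) /\
    (pstar < posterior m p h -> pi p h = 1).

(* Main.v *)
Require Import Defs.
From mathcomp Require Import all_boot all_order all_algebra.
From mathcomp Require Import all_classical all_reals all_analysis.
From mathcomp Require Import ring lra.

(** Write z = (x, y) for the unnormalised belief: x and y are the
    probabilities that the target is undetected and at site 1, respectively
    at site 2. A search acts linearly on z, so a fixed plan of searches has
    cost c . z for a vector c = (X, Y), X and Y being its expected costs
    from site 1 and from site 2, and the optimal cost W is the infimum of
    these linear functions. W is homogeneous and satisfies Bellman's
    equation W z = min_i (C_i |z| + W (step i z)); it is the limit of the
    n-step costs W_n, uniformly on bounded sets. A threshold means that, as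
    the belief in site 1 grows, the difference D between the two terms of
    the minimum changes sign at most once, from positive to negative. The
    reason depends on the sign of the determinant a + b - 1 of the
    transition matrix.

    If a + b <= 1, the threshold is a belief q that maximises W on the
    simplex. Up to an arbitrary error, W is touched from above at z by the
    cost c of a plan; its slope X - Y must be nonnegative when z lies left
    of q and nonpositive when z lies right of q (slope_offset). Searching
    site 1 before c multiplies the slope by a + b - 1 <= 0 and lowers it by
    a fixed amount. So if site 1 is optimal left of q, then the next belief
    is right of q (misplaced_crosses). Site 1 is not optimal there: two
    searches of site 1 lower a positive slope, while by Cayley-Hamilton they
    do not move the belief to the left, which contradicts concavity
    (misplaced_no_repeat). Hence site 2 is optimal there, and by symmetry
    the searches alternate for ever with slopes growing linearly. Large
    slopes only occur near the ends of the simplex, and the belief can jump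
    from each end to the other only if a = b = 0; but then alternating never
    finds a target that starts at site 2 (no_misplaced).

    If a + b > 1, exchange the sites if necessary so that C_1 <= C_2. Then D
    does not increase in x for fixed y, for every horizon. The derivative of
    D in x is C_1 - C_2 + alpha_1 X - X', where X and X' come from optimal
    continuations after a search of site 1 and of site 2. The bound alpha_1
    X - X' <= C_2 - C_1 for optimal plans at beliefs whose odds differ by
    less than the factor 1 / (alpha_1 alpha_2) goes from n to n + 1 by
    comparing the first searches of the two plans (gap_boundedS). The one
    pair of first searches that would break the induction is 1 at the lower
    odds and 2 at the higher odds, and it is ruled out by the monotonicity
    of D at horizon n, which itself follows from the bound at n. The limit
    of the horizons gives the monotonicity for W (opt_advantage_le).

    Finally, the expected cost of a policy lies above its cost over the
    first n epochs for every n, hence above W; for the threshold policy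
    these costs stay below W, which forces detection with probability 1 and
    an expected cost of at most W. *)

Set Implicit Arguments.
Unset Strict Implicit.
Unset Printing Implicit Defensive.

Import Order.TTheory GRing.Theory Num.Theory.
Import numFieldNormedType.Exports.
Local Open Scope classical_set_scope.
Local Open Scope ring_scope.

(** * Unnormalised beliefs and finite horizons *)

Section Model.
Context {R : realType}.
Implicit Types (m : search_model R) (c d z w : R * R) (i : bool).

Definition admissible m : Prop :=
  [/\ 0 <= stay1 m <= 1, 0 <= stay2 m <= 1, 0 <= overlook1 m < 1,
      0 <= overlook2 m < 1 & 0 < cost1 m /\ 0 < cost2 m].

Definition cone z : Prop := 0 <= z.1 /\ 0 <= z.2.

Definition mass z : R := z.1 + z.2.

Definition dot c z : R := c.1 * z.1 + c.2 * z.2.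

Definition survive m i z : R * R :=
  if i then (overlook1 m * z.1, z.2) else (z.1, overlook2 m * z.2).

Definition drift m z : R * R :=
  (stay1 m * z.1 + (1 - stay2 m) * z.2, (1 - stay1 m) * z.1 + stay2 m * z.2).

Definition step m i z : R * R := drift m (survive m i z).

(** Transpose of [drift]: the expectation of [c] after one move, as a function
    of the site before the move. *)
Definition dual_drift m c : R * R :=
  (stay1 m * c.1 + (1 - stay1 m) * c.2, (1 - stay2 m) * c.1 + stay2 m * c.2).

Definition prepend m i c : R * R :=
  if i then (cost1 m + overlook1 m * (dual_drift m c).1, cost1 m + (dual_drift m c).2)
  else (cost2 m + (dual_drift m c).1, cost2 m + overlook2 m * (dual_drift m c).2).

Fixpoint run m (s : seq bool) z : R * R :=
  if s is i :: s' then run m s' (step m i z) else z.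

Fixpoint horizon_cost m n z : R :=
  if n is n'.+1 then
    Num.min (search_cost m true * mass z + horizon_cost m n' (step m true z))
            (search_cost m false * mass z + horizon_cost m n' (step m false z))
  else 0.

Definition horizon_cost_after m n i z : R :=
  search_cost m i * mass z + horizon_cost m n (step m i z).

Definition least_cost m : R := Num.min (cost1 m) (cost2 m).

Definition cost_bound m : R :=
  Num.max (2 * cost1 m / (1 - overlook1 m)) (2 * cost2 m / (1 - overlook2 m)).

Lemma dot_dual_drift m c z : dot (dual_drift m c) z = dot c (drift m z).
Proof. by rewrite /dot /dual_drift /drift /=; ring. Qed.

Lemma dot_prepend m i c z :
  dot (prepend m i c) z = search_cost m i * mass z + dot c (step m i z).
Proof. by case: i; rewrite /dot /prepend /mass /step /drift /=; ring. Qed.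

Lemma mass_drift m z : mass (drift m z) = mass z.
Proof. by rewrite /mass /=; ring. Qed.

Lemma horizonS m n z : horizon_cost m n.+1 z =
  Num.min (horizon_cost_after m n true z) (horizon_cost_after m n false z).
Proof. by []. Qed.

Lemma horizonS_le m n i z : horizon_cost m n.+1 z <= horizon_cost_after m n i z.
Proof. by rewrite horizonS ge_min; case: i; rewrite lexx ?orbT. Qed.

Lemma horizonS_or m n z : horizon_cost m n.+1 z = horizon_cost_after m n true z \/
  horizon_cost m n.+1 z = horizon_cost_after m n false z.
Proof. by rewrite horizonS; case: (leP (horizon_cost_after m n true z));
  [left|right]. Qed.

Section Admissible.
Variable m : search_model R.
Hypothesis hm : admissible m.

Lemma cost_gt0 i : 0 < search_cost m i.
Proof. by case: hm => _ _ _ _ []; case: i. Qed.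

Lemma least_cost_gt0 : 0 < least_cost m.
Proof. by rewrite lt_min (cost_gt0 true) (cost_gt0 false). Qed.

Lemma least_cost_le i : least_cost m <= search_cost m i.
Proof. by rewrite ge_min; case: i; rewrite lexx ?orbT. Qed.

Lemma cost_bound_gt0 : 0 < cost_bound m.
Proof.
case: hm => _ _ /andP[_ h1] _ [C1 _]; rewrite lt_max divr_gt0 //; lra.
Qed.

Lemma cone_mass z : cone z -> 0 <= mass z.
Proof. by case=> h1 h2; rewrite addr_ge0. Qed.

Lemma cone_survive i z : cone z -> cone (survive m i z).
Proof.
case: hm => _ _ /andP[h1 _] /andP[h2 _] _ [z1 z2].
by case: i; split; rewrite /= ?mulr_ge0.
Qed.

Lemma cone_drift z : cone z -> cone (drift m z).
Proof.
case: hm => /andP[a0 a1] /andP[b0 b1] _ _ _ [z1 z2].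
by split; rewrite /= addr_ge0 // mulr_ge0 // subr_ge0.
Qed.

Lemma cone_step i z : cone z -> cone (step m i z).
Proof. by move=> ?; apply: cone_drift; apply: cone_survive. Qed.

Lemma cone_dual_drift c : cone c -> cone (dual_drift m c).
Proof.
case: hm => /andP[a0 a1] /andP[b0 b1] _ _ _ [z1 z2].
by split; rewrite /= addr_ge0 // mulr_ge0 // subr_ge0.
Qed.

Lemma cone_prepend i c : cone c -> cone (prepend m i c).
Proof.
case: hm => _ _ /andP[h1 _] /andP[h2 _] [C1 C2] /cone_dual_drift[z1 z2].
by case: i; split; rewrite /= addr_ge0 ?mulr_ge0 // ltW.
Qed.

Lemma cone_run s z : cone z -> cone (run m s z).
Proof. by elim: s z => //= i s IH z hz; apply/IH/cone_step. Qed.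

Lemma mass_step i z : cone z -> mass (step m i z) <= mass z.
Proof.
case: hm => _ _ /andP[a0 a1] /andP[b0 b1] _ [z1 z2].
rewrite mass_drift /mass; case: i => /=.
  by rewrite lerD2r ler_piMl // ltW.
by rewrite lerD2l ler_piMl // ltW.
Qed.

Lemma mass_run s z : cone z -> mass (run m s z) <= mass z.
Proof.
elim: s z => //= i s IH z hz.
exact: (le_trans (IH _ (cone_step i hz)) (mass_step i hz)).
Qed.

Lemma horizon_ge0 n z : cone z -> 0 <= horizon_cost m n z.
Proof.
elim: n z => // n IH z hz; rewrite horizonS le_min /horizon_cost_after.
by rewrite !addr_ge0 ?mulr_ge0 ?cone_mass ?(ltW (cost_gt0 _)) ?IH //;
   exact: cone_step.
Qed.

Lemma horizon_mono n z : cone z -> horizon_cost m n z <= horizon_cost m n.+1 z.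
Proof.
elim: n z => [|n IH] z hz; first exact: horizon_ge0.
rewrite horizonS le_min /horizon_cost_after; apply/andP; split.
  apply: le_trans (horizonS_le m n true z) _.
  by rewrite lerD2l; apply/IH/cone_step.
apply: le_trans (horizonS_le m n false z) _.
by rewrite lerD2l; apply/IH/cone_step.
Qed.

Lemma horizonZ n t z : 0 <= t ->
  horizon_cost m n (t * z.1, t * z.2) = t * horizon_cost m n z.
Proof.
move=> t0; elim: n z => [|n IH] z; first by rewrite mulr0.
have E i : horizon_cost_after m n i (t * z.1, t * z.2) = t * horizon_cost_after m n i z.
  rewrite /horizon_cost_after [RHS]mulrDr -IH; congr (_ + horizon_cost m n _).
    by rewrite /mass /=; ring.
  by case: i; rewrite /step /drift /=; congr (_, _); ring.
by rewrite !horizonS !E minr_pMr.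
Qed.

Lemma horizon_le n z w : cone z -> z.1 <= w.1 -> z.2 <= w.2 ->
  horizon_cost m n z <= horizon_cost m n w.
Proof.
case: (hm) => /andP[a0 a1] /andP[b0 b1] /andP[p1 p1'] /andP[p2 p2'] _.
elim: n z w => // n IH z w hz h1 h2.
have E i : horizon_cost_after m n i z <= horizon_cost_after m n i w.
  apply: lerD; first by rewrite ler_pM2l ?cost_gt0 // lerD.
  apply: IH; first exact: cone_step.
    by case: i; rewrite /= lerD // ler_wpM2l ?subr_ge0 // ler_wpM2l.
  by case: i; rewrite /= lerD // ler_wpM2l ?subr_ge0 // ler_wpM2l.
rewrite (horizonS m n w) le_min.
by rewrite (le_trans (horizonS_le m n true z)) // (le_trans (horizonS_le m n false z)).
Qed.

(** Searching the likelier site removes at least half of 1 - overlook of the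
    mass, so the remaining cost pays for the search once the constant is
    2 * cost / (1 - overlook). *)
Lemma horizon_le_bound n z : cone z -> horizon_cost m n z <= cost_bound m * mass z.
Proof.
case: (hm) => _ _ /andP[p1 p1'] /andP[p2 p2'] [C1 C2].
elim: n z => [|n IH] z hz.
  by rewrite mulr_ge0 ?cone_mass // ltW // cost_bound_gt0.
have [K1 K2] : 2 * cost1 m <= cost_bound m * (1 - overlook1 m) /\
               2 * cost2 m <= cost_bound m * (1 - overlook2 m).
  by split; rewrite -ler_pdivrMr ?subr_gt0 // le_max lexx ?orbT.
have [z1 z2] := hz; have K0 := cost_bound_gt0.
have [le|lt] := leP z.2 z.1.
  apply: le_trans (horizonS_le m n true z) _.
  apply: le_trans (lerD (lexx _) (IH _ (cone_step true hz))) _.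
  rewrite mass_drift /mass /=.
  have : 0 <= (cost_bound m * (1 - overlook1 m) - 2 * cost1 m) * z.1.
    by rewrite mulr_ge0 // subr_ge0.
  have : 0 <= cost1 m * (z.1 - z.2) by rewrite mulr_ge0 ?subr_ge0 // ltW.
  lra.
apply: le_trans (horizonS_le m n false z) _.
apply: le_trans (lerD (lexx _) (IH _ (cone_step false hz))) _.
rewrite mass_drift /mass /=.
have : 0 <= (cost_bound m * (1 - overlook2 m) - 2 * cost2 m) * z.2.
  by rewrite mulr_ge0 // subr_ge0.
have : 0 <= cost2 m * (z.2 - z.1) by rewrite mulr_ge0 ?subr_ge0 // ltW.
lra.
Qed.

Lemma least_cost_le_horizon n z : cone z ->
  least_cost m * mass z <= horizon_cost m n.+1 z.
Proof.
move=> hz; have E i : least_cost m * mass z <= horizon_cost_after m n i z.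
  rewrite -[leLHS]addr0 lerD ?ler_wpM2r ?cone_mass ?least_cost_le //.
  exact/horizon_ge0/cone_step.
by rewrite horizonS le_min !E.
Qed.

(** Cost vector of the searches in [s], followed by a terminal cost [t] per
    unit of undetected mass. *)
Definition plan_cost (t : R) (s : seq bool) : R * R := foldr (prepend m) (t, t) s.

Lemma plan_cost_cons t i s : plan_cost t (i :: s) = prepend m i (plan_cost t s).
Proof. by []. Qed.

Lemma cone_plan t s : 0 <= t -> cone (plan_cost t s).
Proof. by move=> t0; elim: s => //= i s; exact: cone_prepend. Qed.

Lemma plan_costE t s z :
  dot (plan_cost t s) z = dot (plan_cost 0 s) z + t * mass (run m s z).
Proof.
elim: s z => [|i s IH] z /=; first by rewrite /dot /mass /=; ring.
by rewrite !dot_prepend IH addrA.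
Qed.

Lemma horizon_le_plan s z : horizon_cost m (size s) z <= dot (plan_cost 0 s) z.
Proof.
elim: s z => [|i s IH] z /=; first by rewrite /dot !mul0r addr0.
by rewrite -/(plan_cost 0 s) dot_prepend; apply: le_trans (horizonS_le m _ i z) _;
  rewrite lerD2l.
Qed.

Definition optimal_plan n s z : Prop :=
  size s = n /\ dot (plan_cost 0 s) z = horizon_cost m n z.

Lemma optimal_plan_cons n i s z : optimal_plan n s (step m i z) ->
  horizon_cost m n.+1 z = horizon_cost_after m n i z -> optimal_plan n.+1 (i :: s) z.
Proof. by move=> [sz E] H; split;
  [rewrite /= sz|rewrite plan_cost_cons dot_prepend E H]. Qed.

Lemma optimal_plan_exists n z : exists s, optimal_plan n s z.
Proof.
elim: n z => [|n IH] z; first by exists [::]; split=> //; rewrite /dot /= !mul0r addr0.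
by case: (horizonS_or m n z) => H; [have [s Hs] := IH (step m true z);
  exists (true :: s)
  |have [s Hs] := IH (step m false z); exists (false :: s)]; apply: optimal_plan_cons.
Qed.

(** Bellman's principle: the tail of an optimal plan is optimal after the first
    search. *)
Lemma optimal_plan_uncons n i s z : optimal_plan n.+1 (i :: s) z ->
  optimal_plan n s (step m i z) /\ horizon_cost m n.+1 z = horizon_cost_after m n i z.
Proof.
move=> [[sz]]; rewrite plan_cost_cons dot_prepend => E.
have h1 := horizon_le_plan s (step m i z); rewrite sz in h1.
have h2 := horizonS_le m n i z.
by split; [split=> //|]; apply/eqP; rewrite eq_le; apply/andP; split=> //;
   rewrite /horizon_cost_after in h2 *; lra.
Qed.

(** The undetected mass only decreases, so every epoch costs at least
    [least_cost] times the final one. *)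
Lemma least_cost_run s z : cone z ->
  (size s)%:R * (least_cost m * mass (run m s z)) <= dot (plan_cost 0 s) z.
Proof.
elim: s z => [|i s IH] z hz /=; first by rewrite /dot !mul0r addr0.
rewrite -/(plan_cost 0 s) dot_prepend -natr1 mulrDl mul1r addrC lerD ?IH //;
  last exact: cone_step.
apply: ler_pM; rewrite ?(ltW least_cost_gt0) ?cone_mass ?least_cost_le //.
  exact/cone_run/cone_step.
by rewrite -[run m s _]/(run m (i :: s) z) mass_run.
Qed.

End Admissible.
End Model.

(** * The infinite-horizon optimal cost *)

Section Limit.
Context {R : realType}.
Implicit Types (c d z w : R * R) (i : bool).

Lemma le0_of_natmul_bounded (x B : R) : (forall n, n%:R * x <= B) -> x <= 0.
Proof.
move=> H; rewrite leNgt; apply/negP => x0.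
have /archi_boundP : 0 <= `|B| / x by rewrite divr_ge0 // ltW.
rewrite ltr_pdivrMr // => h.
by have := lt_le_trans h (le_trans (H _) (ler_norm B)); rewrite ltxx.
Qed.

Variable m : search_model R.
Hypothesis hm : admissible m.

Definition opt_cost z : R := sup (range (fun n => horizon_cost m n z)).

Definition opt_cost_after i z : R := search_cost m i * mass z + opt_cost (step m i z).

Lemma horizon_le_opt_cost n z : cone z -> horizon_cost m n z <= opt_cost z.
Proof.
move=> hz; apply: ub_le_sup; last by exists n.
exists (cost_bound m * mass z) => _ [k _ <-]; exact: horizon_le_bound.
Qed.

Lemma opt_cost_le z (B : R) : (forall n, horizon_cost m n z <= B) -> opt_cost z <= B.
Proof.
by move=> H; apply: ge_sup; [exists (horizon_cost m 0 z), 0%N|move=> _ [n _ <-]].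
Qed.

Lemma opt_cost_le_bound z : cone z -> opt_cost z <= cost_bound m * mass z.
Proof. by move=> hz; apply: opt_cost_le => n; exact: horizon_le_bound. Qed.

Lemma least_cost_le_opt_cost z : cone z -> least_cost m * mass z <= opt_cost z.
Proof.
move=> hz; exact: le_trans (least_cost_le_horizon hm 0 hz) (horizon_le_opt_cost 1 hz).
Qed.

Lemma opt_cost_ge0 z : cone z -> 0 <= opt_cost z.
Proof. by move=> hz; exact: (horizon_le_opt_cost 0 hz). Qed.

Lemma opt_costZ t z : cone z -> 0 <= t -> opt_cost (t * z.1, t * z.2) = t * opt_cost z.
Proof.
move=> hz t0.
have htz : cone (t * z.1, t * z.2) by case: hz; split; rewrite /= mulr_ge0.
apply/eqP; rewrite eq_le; apply/andP; split.
  by apply: opt_cost_le => n; rewrite horizonZ // ler_wpM2l // horizon_le_opt_cost.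
have [->|tn0] := eqVneq t 0; first by rewrite mul0r; apply: opt_cost_ge0; split;
  rewrite /= mul0r.
rewrite -ler_pdivlMl ?lt_def ?tn0 //; apply: opt_cost_le => n.
by rewrite ler_pdivlMl ?lt_def ?tn0 // -horizonZ // horizon_le_opt_cost.
Qed.

Lemma opt_cost_afterZ t i z : cone z -> 0 <= t ->
  opt_cost_after i (t * z.1, t * z.2) = t * opt_cost_after i z.
Proof.
move=> hz t0; rewrite /opt_cost_after [RHS]mulrDr -(opt_costZ (cone_step hm i hz) t0).
congr (_ + opt_cost _); first by rewrite /mass /=; ring.
by case: i; rewrite /step /drift /=; congr (_, _); ring.
Qed.

Lemma opt_cost_le_after i z : cone z -> opt_cost z <= opt_cost_after i z.
Proof.
move=> hz; apply: opt_cost_le => n; apply: le_trans (horizon_mono hm n hz) _.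
apply: le_trans (horizonS_le m n i z) _.
by rewrite lerD2l; apply/horizon_le_opt_cost/cone_step.
Qed.

Definition dominates c : Prop := forall z, cone z -> opt_cost z <= dot c z.

Lemma dominates_prepend i c : dominates c -> dominates (prepend m i c).
Proof.
move=> hc z hz; apply: le_trans (opt_cost_le_after i hz) _.
by rewrite dot_prepend lerD2l; apply/hc/cone_step.
Qed.

Lemma dominates_bound : dominates (cost_bound m, cost_bound m).
Proof.
move=> z hz; apply: le_trans (opt_cost_le_bound hz) _.
by rewrite /dot /mass /= mulrDr.
Qed.

Lemma dominates_plan s : dominates (plan_cost m (cost_bound m) s).
Proof. by elim: s => [|i s]; [exact: dominates_bound|exact: dominates_prepend]. Qed.

(** An optimal [n]-step plan leaves at most a multiple of 1 / n undetected,
    and a terminal cost of [cost_bound] makes its cost vector dominate the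
    infinite-horizon cost. *)
Lemma near_tangent_horizon n z : cone z -> exists c,
  [/\ cone c, dominates c &
    n%:R * (least_cost m * (dot c z - horizon_cost m n z)) <=
      cost_bound m ^+ 2 * mass z].
Proof.
move=> hz; have [s [sz E]] := optimal_plan_exists m n z.
have K0 := cost_bound_gt0 hm.
exists (plan_cost m (cost_bound m) s); split;
  [exact/cone_plan/ltW|exact: dominates_plan|].
rewrite plan_costE E addrAC subrr add0r.
have h1 := least_cost_run hm s hz; rewrite sz E in h1.
have h2 := horizon_le_bound hm n hz.
have : cost_bound m * (n%:R * (least_cost m * mass (run m s z))) <=
       cost_bound m * (cost_bound m * mass z).
  by rewrite ler_pM2l // (le_trans h1 h2).
by rewrite expr2 -mulrA; congr (_ <= _); ring.
Qed.

Lemma opt_cost_sub_horizon n z : cone z ->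
  n%:R * (least_cost m * (opt_cost z - horizon_cost m n z)) <=
    cost_bound m ^+ 2 * mass z.
Proof.
move=> hz; have [c [_ hc]] := near_tangent_horizon n hz; apply: le_trans.
rewrite ler_wpM2l // ler_pM2l ?least_cost_gt0 // lerD2r; exact: hc.
Qed.

Lemma horizon_close (e B : R) : 0 < e -> exists n, forall z, cone z -> mass z <= B ->
  opt_cost z - horizon_cost m n z <= e /\
  exists c, [/\ cone c, dominates c & dot c z <= horizon_cost m n z + e].
Proof.
move=> e0; have l0 := least_cost_gt0 hm.
have [n0 hn] : exists n, cost_bound m ^+ 2 * B <= n.+1%:R * (least_cost m * e).
  have le0 : 0 < least_cost m * e by rewrite mulr_gt0.
  have /archi_boundP : 0 <= `|cost_bound m ^+ 2 * B| / (least_cost m * e).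
    by rewrite divr_ge0 // ltW.
  rewrite ltr_pdivrMr // => h; eexists.
  apply: le_trans (ler_norm _) (le_trans (ltW h) _).
  by rewrite ler_wpM2r ?(ltW le0) // ler_nat.
pose n := n0.+1.
have E x : n%:R * (least_cost m * x) <= n%:R * (least_cost m * e) -> x <= e.
  by rewrite ler_pM2l ?ltr0n // ler_pM2l.
exists n => z hz hB.
have hK : cost_bound m ^+ 2 * mass z <=
  cost_bound m ^+ 2 * B by rewrite ler_wpM2l ?sqr_ge0.
split; first by apply: E; apply: le_trans (opt_cost_sub_horizon n hz) (le_trans hK hn).
have [c [c0 hc h]] := near_tangent_horizon n hz; exists c; split=> //.
by rewrite addrC -lerBlDr; apply: E; apply: le_trans h (le_trans hK hn).
Qed.

(** Bellman's equation passes to the limit because the horizons converge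
    uniformly. *)
Lemma opt_cost_after_or z : cone z ->
  opt_cost z = opt_cost_after true z \/ opt_cost z = opt_cost_after false z.
Proof.
move=> hz.
have [//|n1] := eqVneq (opt_cost z) (opt_cost_after true z); first by left.
have [//|n2] := eqVneq (opt_cost z) (opt_cost_after false z); first by right.
have h1 : opt_cost z < opt_cost_after true z by rewrite lt_def eq_sym n1
  opt_cost_le_after.
have h2 : opt_cost z < opt_cost_after false z by rewrite lt_def eq_sym n2
  opt_cost_le_after.
pose e := Num.min (opt_cost_after true z - opt_cost z) (opt_cost_after false z -
  opt_cost z).
have e0 : 0 < e by rewrite lt_min !subr_gt0 h1 h2.
have [n Hn] := @horizon_close (e / 2) (mass z) (divr_gt0 e0 (ltr0n _ 2)).
have G i : opt_cost_after i z - opt_cost z <= e / 2 -> False.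
  have : e <= opt_cost_after i z - opt_cost z by rewrite ge_min; case: i;
    rewrite lexx ?orbT.
  lra.
have F i : horizon_cost m n.+1 z = horizon_cost_after m n i z -> False.
  move=> H; apply: (G i); have := horizon_le_opt_cost n.+1 hz; rewrite H.
  have [+ _] := Hn _ (cone_step hm i hz) (mass_step hm i hz).
  by rewrite /opt_cost_after /horizon_cost_after; lra.
by case: (horizonS_or m n z) => /F.
Qed.

(** An approximate supergradient of the optimal cost at [z].  The error [e] is
    needed because a supergradient can be infinite at the ends of the simplex. *)
Definition tangent (e : R) c z : Prop :=
  [/\ cone c, dominates c & dot c z <= opt_cost z + e].

Lemma tangent_exists e z : 0 < e -> cone z -> exists c, tangent e c z.
Proof.
move=> e0 hz; have [n /(_ z hz (lexx _))[_ [c [c0 hc h]]]] := horizon_close (mass z) e0.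
by exists c; split=> //; apply: le_trans h _; rewrite lerD2r horizon_le_opt_cost.
Qed.

(** Tangents are transported backwards along optimal searches, without loss. *)
Lemma tangent_prepend e c i z : opt_cost z = opt_cost_after i z ->
  tangent e c (step m i z) -> tangent e (prepend m i c) z.
Proof.
move=> E [c0 hc h]; split; [exact: cone_prepend|exact: dominates_prepend|].
by rewrite dot_prepend E /opt_cost_after -addrA lerD2l.
Qed.

Lemma plan_cost_le s :
  (plan_cost m 0 s).1 <= (size s)%:R * (cost1 m + cost2 m) /\
  (plan_cost m 0 s).2 <= (size s)%:R * (cost1 m + cost2 m).
Proof.
case: (hm) => /andP[a0 a1] /andP[b0 b1] /andP[p0 p1] /andP[r0 r1] [C1 C2].
elim: s => [|i s [h1 h2]]; first by rewrite /= !mul0r.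
have [q1 q2] := cone_dual_drift hm (cone_plan hm s (lexx 0)).
move: h1 h2 q1 q2; rewrite plan_cost_cons [size _]/= -natr1 mulrDl mul1r.
set B := _ * _; move: (plan_cost m 0 s) => c h1 h2 q1 q2.
have k1 : (dual_drift m c).1 <= B.
  rewrite /=; have : 0 <= stay1 m * (B - c.1) by rewrite mulr_ge0 // subr_ge0.
  have : 0 <= (1 - stay1 m) * (B - c.2) by rewrite mulr_ge0 // subr_ge0.
  lra.
have k2 : (dual_drift m c).2 <= B.
  rewrite /=; have : 0 <= stay2 m * (B - c.2) by rewrite mulr_ge0 // subr_ge0.
  have : 0 <= (1 - stay2 m) * (B - c.1) by rewrite mulr_ge0 // subr_ge0.
  lra.
have e1 : overlook1 m * (dual_drift m c).1 <=
  (dual_drift m c).1 by rewrite ler_piMl // ltW.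
have e2 : overlook2 m * (dual_drift m c).2 <=
  (dual_drift m c).2 by rewrite ler_piMl // ltW.
rewrite /prepend; move: (dual_drift m c) k1 k2 e1 e2 {q1 q2} => g k1 k2 e1 e2.
by case: i => /=; split; lra.
Qed.

Lemma horizon_lipschitz n z w : cone z -> cone w ->
  horizon_cost m n z <= horizon_cost m n w +
    n%:R * (cost1 m + cost2 m) * (`|z.1 - w.1| + `|z.2 - w.2|).
Proof.
move=> hz hw; have [s [sz <-]] := optimal_plan_exists m n w.
rewrite -sz; apply: le_trans (horizon_le_plan m s z) _.
have [h1 h2] := plan_cost_le s; have [q1 q2] := cone_plan hm s (lexx 0).
rewrite -lerBlDl /dot mulrDr.
have -> : forall a b x y u v : R, a * x + b * y - (a * u + b * v) =
  a * (x - u) + b * (y - v).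
  by move=> *; ring.
apply: lerD.
  by apply: le_trans (ler_wpM2l q1 (ler_norm _)) _; rewrite ler_wpM2r.
by apply: le_trans (ler_wpM2l q2 (ler_norm _)) _; rewrite ler_wpM2r.
Qed.

(** The absolute values keep the argument in the cone for all real [p], so that
    continuity can be stated on the whole line. *)
Lemma opt_cost_simplex_continuous : continuous (fun p : R => opt_cost (`|p|, `|1 - p|)).
Proof.
have C0 (p : R) : cone (`|p|, `|1 - p|) by split; rewrite /= normr_ge0.
have [C1 C2] : 0 < cost1 m /\ 0 < cost2 m by case: hm.
move=> p; apply/cvgrPdist_le => e e0.
have e4 : 0 < e / 4 by rewrite divr_gt0.
have [n Hn] := @horizon_close (e / 4) (3 + 2 * `|p|) e4.
pose L := n%:R * (cost1 m + cost2 m).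
have L0 : 0 <= L by rewrite mulr_ge0 // addr_ge0 // ltW.
pose dl := Num.min 1 (e / 4 / (L + 1)).
have dl0 : 0 < dl by rewrite lt_min ltr01 divr_gt0 // ltr_wpDl.
near=> q.
have pq : `|p - q| < dl by near: q; exact: (@cvgr_dist_lt _ _ _ _ _ id).
have /andP[pq1 pq2] : (`|p - q| < 1) && (`|p - q| < e / 4 / (L + 1)).
  by rewrite -lt_min.
have hL : L * `|p - q| <= e / 4.
  rewrite ltr_pdivlMr in pq2; last by rewrite ltr_wpDl.
  have : 0 <= `|p - q| by []. lra.
have d1 (x y : R) : `| `|x| - `|y| | <= `|x - y| by exact: ler_dist_dist.
have n1 : `|q| <= `|p| + 1.
  by have := d1 q p; have := ler_norm (`|q| - `|p|); rewrite (distrC q p); lra.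
have n2 : `|1 - p| <= 1 + `|p| by rewrite (le_trans (ler_normB _ _)) // normr1.
have n3 : `|1 - q| <= 1 + `|q| by rewrite (le_trans (ler_normB _ _)) // normr1.
have [g1 _] := Hn (`|p|, `|1 - p|) (C0 _) ltac:(rewrite /mass /=; lra).
have [g2 _] := Hn (`|q|, `|1 - q|) (C0 _) ltac:(rewrite /mass /=; lra).
have l1 := horizon_lipschitz n (C0 p) (C0 q).
have l2 := horizon_lipschitz n (C0 q) (C0 p).
have f1 := horizon_le_opt_cost n (C0 p).
have f2 := horizon_le_opt_cost n (C0 q).
rewrite -/L [fst _]/= [snd _]/= in l1; rewrite -/L [fst _]/= [snd _]/= in l2.
have b1 : L * (`| `|p| - `|q| | + `| `|1 - p| - `|1 - q| |) <= L * (2 * `|p - q|).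
  rewrite ler_wpM2l //; have := d1 p q; have := d1 (1 - p) (1 - q).
  have -> : 1 - p - (1 - q) = q - p by ring. rewrite (distrC q p); lra.
have b2 : L * (`| `|q| - `|p| | + `| `|1 - q| - `|1 - p| |) <= L * (2 * `|p - q|).
  by rewrite (distrC `|q|) (distrC `|1 - q|).
rewrite ler_norml; apply/andP; split; lra.
Unshelve. all: by end_near.
Qed.

(** By homogeneity, a maximum of the optimal cost on the simplex becomes a
    constant vector that dominates it on the cone. *)
Lemma opt_cost_max_exists : exists2 q : R, 0 <= q <= 1 &
  dominates (opt_cost (q, 1 - q), opt_cost (q, 1 - q)).
Proof.
have [q] := @EVT_max R _ 0 1 ler01
  (continuous_subspaceT opt_cost_simplex_continuous).
rewrite in_itv /= => /andP[q0 q1] H; exists q; first by rewrite q0.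
have V (p : R) : 0 <= p <= 1 -> opt_cost (`|p|, `|1 - p|) = opt_cost (p, 1 - p).
  by case/andP => p0 p1; rewrite !ger0_norm // subr_ge0.
move=> z hz; have [h1 h2] := hz.
have [M0|Mn0] := eqVneq (mass z) 0.
  have := opt_cost_le_bound hz; rewrite M0 mulr0 => /le_trans; apply.
  have [q' q''] : 0 <= q /\ 0 <= 1 - q by split=> //; rewrite subr_ge0.
  by rewrite /dot /= addr_ge0 // mulr_ge0 // opt_cost_ge0.
have M0 : 0 < mass z by rewrite lt_def Mn0 cone_mass.
pose p := z.1 / mass z.
have p01 : 0 <= p <= 1.
  by rewrite divr_ge0 ?cone_mass //= ler_pdivrMr // mul1r /mass lerDl.
have Ep1 : mass z * p = z.1 by rewrite mulrC divfK.
have Ep2 : mass z * (1 - p) = z.2 by rewrite mulrBr mulr1 Ep1 /mass; ring.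
have -> : opt_cost z = mass z * opt_cost (p, 1 - p).
  rewrite -opt_costZ ?cone_mass //=; last by case/andP: p01; split;
    rewrite //= subr_ge0.
  by rewrite Ep1 Ep2; case: (z).
have := H p; rewrite in_itv /= p01 => /(_ isT); rewrite !V ?q0 // => h.
rewrite /dot /= -mulrDr mulrC; apply: ler_wpM2r => //; exact: cone_mass.
Qed.

End Limit.

(** * Exchanging the two sites *)

Section Swap.
Context {R : realType}.
Implicit Types (m : search_model R) (c d z w : R * R) (i : bool).

(** Stated on the cone, which covers all beliefs at once and is stable under
    exchanging the sites. *)
Definition has_threshold m : Prop := exists2 q : R, 0 <= q <= 1 &
  forall z, cone z ->
    (z.1 < q * mass z -> opt_cost_after m false z <= opt_cost_after m true z) /\
    (q * mass z < z.1 -> opt_cost_after m true z <= opt_cost_after m false z).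

Definition swap_model m : search_model R :=
  SearchModel (stay2 m) (stay1 m) (overlook2 m) (overlook1 m) (cost2 m) (cost1 m).

Definition swap z : R * R := (z.2, z.1).

Lemma swapK z : swap (swap z) = z. Proof. by case: z. Qed.

Lemma swap_modelK m : swap_model (swap_model m) = m. Proof. by case: m. Qed.

Lemma admissible_swap m : admissible m -> admissible (swap_model m).
Proof. by case=> ? ? ? ? []. Qed.

Lemma cone_swap z : cone z -> cone (swap z).
Proof. by case. Qed.

Lemma mass_swap z : mass (swap z) = mass z.
Proof. exact: addrC. Qed.

Lemma step_swap m i z : step (swap_model m) i (swap z) = swap (step m (~~ i) z).
Proof. by case: i; rewrite /step /swap /drift /=; congr (_, _); rewrite addrC. Qed.

Lemma search_cost_swap m i : search_cost (swap_model m) i = search_cost m (~~ i).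
Proof. by case: i. Qed.

Lemma horizon_swap m n z : horizon_cost (swap_model m) n (swap z) = horizon_cost m n z.
Proof.
elim: n z => // n IH z.
by rewrite !horizonS /horizon_cost_after !search_cost_swap !step_swap mass_swap !IH
  minC.
Qed.

Lemma opt_cost_swap m z : opt_cost (swap_model m) (swap z) = opt_cost m z.
Proof. by congr sup; apply: eq_imagel => n _; exact: horizon_swap. Qed.

Lemma opt_cost_after_swap m i z :
  opt_cost_after (swap_model m) i (swap z) = opt_cost_after m (~~ i) z.
Proof. by rewrite /opt_cost_after search_cost_swap mass_swap step_swap opt_cost_swap.
  Qed.

Lemma dot_swap c z : dot (swap c) (swap z) = dot c z.
Proof. by rewrite /dot addrC. Qed.

Lemma dominates_swap m c : dominates m c -> dominates (swap_model m) (swap c).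
Proof.
by move=> hc z hz; rewrite -(swapK z) opt_cost_swap dot_swap; apply/hc/cone_swap.
Qed.

Lemma tangent_swap m e c z : tangent m e c z ->
  tangent (swap_model m) e (swap c) (swap z).
Proof.
by case=> c0 hc h; split;
  [exact: cone_swap|exact: dominates_swap|rewrite dot_swap opt_cost_swap].
Qed.

Lemma has_threshold_swap m : has_threshold (swap_model m) -> has_threshold m.
Proof.
case=> q q01 H; exists (1 - q); first lra.
move=> z hz; have := H _ (cone_swap hz); rewrite !opt_cost_after_swap mass_swap /=.
by rewrite /mass => -[h1 h2]; split=> h; [apply: h2|apply: h1]; lra.
Qed.

End Swap.

(** * The threshold when a + b <= 1 *)

Section Anticorrelated.
Context {R : realType}.
Implicit Types (m : search_model R) (c d z w : R * R) (i : bool) (q e s : R).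

(** Derivative of [dot c] along the simplex, in the direction of site 1. *)
Definition slope c : R := c.1 - c.2.

(** Negative when the belief [z.1 / mass z] lies left of [q], and linear in
    [z]. *)
Definition offset q z : R := z.1 - q * mass z.

Definition maximal_belief m q : Prop :=
  0 <= q <= 1 /\ dominates m (opt_cost m (q, 1 - q), opt_cost m (q, 1 - q)).

Definition anticorrelated m : Prop := admissible m /\ stay1 m + stay2 m <= 1.

Lemma anticorrelated_swap m : anticorrelated m -> anticorrelated (swap_model m).
Proof. by case=> /admissible_swap ? ?; split=> //=; rewrite addrC. Qed.

Lemma maximal_belief_swap m q :
  maximal_belief m q -> maximal_belief (swap_model m) (1 - q).
Proof.
case=> q01 H; split; first lra.
have -> : (1 - q, 1 - (1 - q)) = swap (q, 1 - q) by rewrite /swap /=; congr (_, _);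
  ring.
by rewrite opt_cost_swap; exact: (dominates_swap H).
Qed.

Lemma slope_swap c : slope (swap c) = - slope c.
Proof. by rewrite /slope opprB. Qed.

Lemma offset_swap q z : offset (1 - q) (swap z) = - offset q z.
Proof. by rewrite /offset mass_swap /mass /=; ring. Qed.

(** A function that dominates the optimal cost and nearly touches it at [z] must
    reach the maximum at [q], hence slopes upwards from [z] to [q]. *)
Lemma slope_offset m q e c z : maximal_belief m q -> cone z ->
  tangent m e c z -> slope c * offset q z <= e.
Proof.
case=> /andP[q0 q1] H hz [c0 hc h].
have h1 := hc (q, 1 - q) ltac:(by split; rewrite //= subr_ge0).
have h2 := H z hz.
have : 0 <= (dot c (q, 1 - q) - opt_cost m (q, 1 - q)) * mass z.
  by rewrite mulr_ge0 ?subr_ge0 ?cone_mass.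
move: h h2; rewrite /dot /slope /offset /mass /=; lra.
Qed.

Definition slope_gain m : R :=
  Num.min (1 - overlook1 m) (1 - overlook2 m) * least_cost m.

Lemma slope_gain_swap m : slope_gain (swap_model m) = slope_gain m.
Proof. by rewrite /slope_gain /least_cost /= minC (minC (cost2 m)). Qed.

Lemma slope_gain_gt0 m : admissible m -> 0 < slope_gain m.
Proof.
move=> hm; case: (hm) => _ _ /andP[_ h1] /andP[_ h2] _.
by rewrite mulr_gt0 ?least_cost_gt0 // lt_min !subr_gt0 h1.
Qed.

(** Searching site 1 is cheaper for a target at site 1, by the detected part of
    its remaining cost, and the move multiplies slopes by the determinant of the
    transition matrix. *)
Lemma slope_prepend m c : anticorrelated m -> cone c -> dominates m c ->
  slope (prepend m true c) <= (stay1 m + stay2 m - 1) * slope c - slope_gain m.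
Proof.
case=> hm hb c0 hc; case: (hm) => /andP[a0 a1] _ /andP[p0 p1] _ _.
have ha : cone (stay1 m, 1 - stay1 m) by split; rewrite //= subr_ge0.
have h1 := le_trans (least_cost_le_opt_cost hm ha) (hc _ ha).
have h2 : slope_gain m <= (1 - overlook1 m) * (dual_drift m c).1.
  apply: ler_pM; rewrite ?(ltW (least_cost_gt0 hm)) //.
  - by rewrite le_min !subr_ge0; case: (hm) => _ _ /andP[_ /ltW ->] /andP[_ /ltW ->].
  - by rewrite ge_min lexx.
  - by move: h1; rewrite /mass /dot /=; congr (_ <= _); ring.
by move: h2; rewrite /slope /=; lra.
Qed.

(** The determinant enters squared, so a positive slope shrinks before the loss
    is subtracted.  A negative slope contributes nothing positive, because the
    cost from site 1 after a move is at least the determinant times the slope. *)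
Lemma slope_prepend_twice m c : anticorrelated m -> cone c ->
  slope (prepend m true (prepend m true c)) <=
    Num.max (slope c) 0 - (1 - overlook1 m) * cost1 m.
Proof.
case=> hm hb c0; case: (hm) => /andP[a0 a1] /andP[b0 b1] /andP[p0 p1] _ _.
have [g1 g2] := cone_dual_drift hm c0.
pose a := stay1 m; pose b := stay2 m; pose al := overlook1 m.
have -> : slope (prepend m true (prepend m true c)) =
    (a + b - 1) * (b - al * (1 - a)) * slope c
    - (1 - al) * (b + a * al) * (dual_drift m c).1 - (1 - al) * cost1 m.
  by rewrite /slope /=; rewrite -/a -/b -/al; ring.
rewrite -/al lerD2r; rewrite -/a -/b in a0 a1 b0 b1 hb.
set g := (dual_drift m c).1 in g1 *.
rewrite -/al in p0 p1.
have sl : (a + b - 1) * slope c = g - (dual_drift m c).2.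
  by rewrite /slope /g /= -/a -/b; ring.
clearbody a b al g.
have ab0 : 0 <= 1 - a - b by lra.
have ab1 : 1 - a - b <= 1 by lra.
have k0 : 0 <= (1 - al) * (b + a * al).
  by rewrite mulr_ge0 ?subr_ge0 ?(ltW p1) // addr_ge0 // mulr_ge0.
have [c1|c1] := leP 0 (slope c).
  have h1 : 0 <= (1 - a - b) * (1 - al) * (1 - a) * slope c.
    by rewrite !mulr_ge0 // subr_ge0 // ltW.
  have h2 : (1 - a - b) ^+ 2 * slope c <= slope c.
    by rewrite ler_piMl // expr_le1.
  have h3 := mulr_ge0 k0 g1.
  lra.
have h1 : 0 <= (a + b - 1) * slope c by apply: mulr_le0; [lra|exact: ltW].
have h2 : (a + b - 1) * slope c <= g.
  by rewrite sl lerBlDr lerDl.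
have h3 : b - al * (1 - a) <= (1 - al) * (b + a * al).
  have : 0 <= al * (1 - b - a * al).
    rewrite mulr_ge0 //; have : a * al <= a by rewrite ler_piMr // ltW.
    lra.
  lra.
have h4 : (a + b - 1) * slope c * (b - al * (1 - a)) <=
          (a + b - 1) * slope c * ((1 - al) * (b + a * al)) by rewrite ler_wpM2l.
have h5 : (a + b - 1) * slope c * ((1 - al) * (b + a * al)) <=
          g * ((1 - al) * (b + a * al)) by rewrite ler_wpM2r.
lra.
Qed.

Lemma tangent_maximal m q z : admissible m -> maximal_belief m q -> cone z ->
  offset q z = 0 ->
  tangent m 0 (opt_cost m (q, 1 - q), opt_cost m (q, 1 - q)) z.
Proof.
move=> hm [/andP[q0 q1] H] hz E.
have hq : cone (q, 1 - q) by split; rewrite //= subr_ge0.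
split=> //; first by split; exact: opt_cost_ge0.
have -> : z = (mass z * q, mass z * (1 - q)).
  by move: E; case: (z) => x y; rewrite /offset /mass /= => E; congr (_, _); lra.
rewrite (opt_costZ hm (z := (q, 1 - q))) ?cone_mass // /dot /=.
by rewrite -mulrDr mulrC addr0 -mulrDr addrCA subrr addr0 mulr1.
Qed.

(** Site 1 is optimal although [z] lies left of the maximal belief.  The aim is
    to refute this; for site 2 on the right it is the same statement for the
    exchanged model. *)
Definition misplaced m q z : Prop :=
  [/\ cone z, offset q z < 0 & opt_cost m z = opt_cost_after m true z].

(** A nonnegative slope before the search requires, as a + b - 1 <= 0, a
    definitely negative slope after it. *)
Lemma misplaced_crosses m q z : anticorrelated m -> maximal_belief m q ->
  misplaced m q z ->
  0 < offset q (step m true z).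
Proof.
move=> hn hq [hz l0 E]; have [hm hb] := hn; rewrite ltNge; apply/negP => s0.
have hs := cone_step hm true hz; set s := step m true z in s0 hs.
have k0 := slope_gain_gt0 hm; set k := slope_gain m in k0.
have [/andP[a0 _] /andP[b0 _] _ _ _] := hm.
have key e c : tangent m e c s -> e <= k / 2 * - offset q z -> slope c <= - (k / 2).
  move=> hc he; have [c0 cd _] := hc.
  have h1 := slope_offset hq hz (tangent_prepend hm E hc).
  have h2 := slope_prepend hn c0 cd; rewrite -/k in h2.
  have h3 : - (k / 2) <= slope (prepend m true c).
    rewrite -(ler_pM2r (x := - offset q z)) ?oppr_gt0 //; lra.
  have h4 : k / 2 <= (stay1 m + stay2 m - 1) * slope c by lra.
  have [h5|h5] := leP 0 (slope c).
    have : 0 <= (1 - stay1 m - stay2 m) * slope c by rewrite mulr_ge0 //; lra.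
    lra.
  have : 0 <= (stay1 m + stay2 m) * - slope c by rewrite mulr_ge0 ?addr_ge0 //; lra.
  lra.
move: s0; rewrite le_eqVlt => /orP[/eqP s0|s0].
  have hk : 0 <= k / 2 * - offset q z.
    by rewrite mulr_ge0 ?divr_ge0 ?oppr_ge0 // ltW.
  by have := key 0 _ (tangent_maximal hm hq hs s0) hk; rewrite /slope subrr; lra.
(* small enough for [key], and for the slope at [s] to be above -k / 2 *)
pose e := Num.min (k / 2 * - offset q z) (k / 4 * - offset q s).
have e0 : 0 < e.
  by rewrite lt_min; apply/andP; split; rewrite mulr_gt0 ?divr_gt0 ?oppr_gt0.
have [c hc] := tangent_exists hm e0 hs.
have h1 := slope_offset hq hs hc.
have h2 := key _ _ hc ltac:(by rewrite ge_min lexx).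
have h3 : e <= k / 4 * - offset q s by rewrite ge_min lexx orbT.
have : k / 2 * - offset q s <= - slope c * - offset q s.
  by rewrite ler_pM2r ?oppr_gt0 //; lra.
have : 0 < k * - offset q s by rewrite mulr_gt0 ?oppr_gt0.
lra.
Qed.

Lemma offset_lt0_mass q z : 0 <= q <= 1 -> cone z -> offset q z < 0 -> 0 < mass z.
Proof.
case/andP=> q0 q1 [z1 z2]; rewrite /offset /mass => h.
rewrite lt_def addr_ge0 // andbT; apply/eqP => H; move: h; rewrite H mulr0 subr0; lra.
Qed.

(** By Cayley-Hamilton, the belief after two searches of site 1 is on the same
    side of [z] as after one, scaled by the trace of the step.  If the trace is
    positive, that belief is right of [z] although its slopes are larger,
    against concavity.  If the trace is 0, two searches only rescale [z], and the
    plan that searches site 1 for ever is an exact tangent of negative slope. *)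
Lemma misplaced_no_repeat m q z : anticorrelated m -> maximal_belief m q ->
  misplaced m q z ->
  opt_cost m (step m true z) = opt_cost_after m true (step m true z) -> False.
Proof.
move=> hn hq hw E2; have s0 := misplaced_crosses hn hq hw; have [hz l0 E] := hw.
have [hm hb] := hn; have [/andP[a0 a1] /andP[b0 b1] /andP[p0 p1] _ [C1 _]] := hm.
have hs := cone_step hm true hz; have ho := cone_step hm true hs.
have zm := offset_lt0_mass (proj1 hq) hz l0.
set s := step m true z in s0 hs ho E2; set o := step m true s in ho.
pose k := (1 - overlook1 m) * cost1 m.
have k0 : 0 < k by rewrite mulr_gt0 // subr_gt0.
pose tr := overlook1 m * stay1 m + stay2 m.
have tr0 : 0 <= tr by rewrite addr_ge0 ?mulr_ge0.
(* D > 0 means that [o] has higher odds of site 1 than [z] *)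
pose D := o.1 * z.2 - z.1 * o.2.
have DE : D = tr * (s.1 * z.2 - z.1 * s.2).
  by rewrite /D /o /s /tr /step /drift /=; ring.
have sz : 0 < s.1 * z.2 - z.1 * s.2.
  have -> : s.1 * z.2 - z.1 * s.2 = offset q s * mass z - offset q z * mass s.
    by rewrite /offset /mass; ring.
  have h1 : 0 < offset q s * mass z by rewrite mulr_gt0.
  have h2 : 0 <= - offset q z * mass s by rewrite mulr_ge0 ?cone_mass // oppr_ge0 ltW.
  lra.
move: tr0; rewrite le_eqVlt => /orP[/eqP tr0|tr0]; last first.
  have D0 : 0 < D by rewrite DE mulr_gt0.
  have M0 : 0 <= mass o + mass z by rewrite addr_ge0 ?cone_mass.
  pose e := Num.min (k / 2 * - offset q z) (D * k / (2 * (mass o + mass z + 1))).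
  have e0 : 0 < e.
    rewrite lt_min; apply/andP; split; first by rewrite mulr_gt0 ?divr_gt0 ?oppr_gt0.
    apply: divr_gt0; first exact: mulr_gt0.
    by apply: mulr_gt0 => //; lra.
  have [c hc] := tangent_exists hm e0 ho.
  have hd := tangent_prepend hm E (tangent_prepend hm E2 hc).
  have [c0 cd ct] := hc; have [_ dd dt] := hd.
  have h1 := slope_offset hq hz hd.
  have h2 := slope_prepend_twice hn c0; rewrite -/k in h2.
  set d := prepend m true (prepend m true c) in hd dd dt h1 h2.
  have e1 : e <= k / 2 * - offset q z by rewrite ge_min lexx.
  have e2 : (mass o + mass z) * e <= D * k / 2.
    have : e <= D * k / (2 * (mass o + mass z + 1)) by rewrite ge_min lexx orbT.
    rewrite ler_pdivlMr; last lra.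
    lra.
  have h3 : - (k / 2) <= slope d.
    rewrite -(ler_pM2r (x := - offset q z)) ?oppr_gt0 //; lra.
  have h4 : slope d + k <= slope c.
    by move: h2; case: (leP (slope c) 0) => ?; lra.
  have f1 : 0 <= (dot c z + e - dot d z) * mass o.
    rewrite mulr_ge0 ?cone_mass //; have := cd z hz; lra.
  have f2 : 0 <= (dot d o + e - dot c o) * mass z.
    rewrite mulr_ge0 ?cone_mass //; have := dd o ho; lra.
  have f3 : D * (slope c - slope d) <= (mass o + mass z) * e.
    by move: f1 f2; rewrite /D /slope /dot /mass; lra.
  have f4 : D * k <= D * (slope c - slope d) by rewrite ler_pM2l //; lra.
  have : 0 < D * k by rewrite mulr_gt0.
  lra.
have [al0 b_0] : overlook1 m * stay1 m = 0 /\ stay2 m = 0.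
  have : 0 <= overlook1 m * stay1 m by rewrite mulr_ge0.
  by move: tr0; rewrite /tr; lra.
pose la := overlook1 m * (1 - stay1 m).
have la1 : la < 1.
  by rewrite (le_lt_trans _ p1) // ler_piMr // gerBl.
have la0 : 0 <= la by rewrite mulr_ge0 // subr_ge0.
have two w : cone w -> opt_cost_after m true (step m true w) + cost1 m * mass w =
    cost1 m * ((1 + la) * w.1 + 2 * w.2) + la * opt_cost m w.
  move=> hw'; rewrite -opt_costZ // /opt_cost_after /=.
  have -> : step m true (step m true w) = (la * w.1, la * w.2).
    rewrite /step /drift /la /= b_0; congr (_, _); last by ring: al0.
    by ring: al0.
  by rewrite /step mass_drift /mass /la /=; ring: al0.
have one w : opt_cost_after m true w =
  cost1 m * mass w + opt_cost m (step m true w) by [].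
(* the cost of searching site 1 for ever: two searches scale the mass by [la] *)
pose c : R * R := (cost1 m * (1 + la) / (1 - la), cost1 m * 2 / (1 - la)).
have dotc w : (1 - la) * dot c w = cost1 m * ((1 + la) * w.1 + 2 * w.2).
  by rewrite /dot /c /=; field; rewrite subr_eq0 gt_eqF.
have hc : tangent m 0 c z.
  split.
  - by split; rewrite /= mulr_ge0 ?invr_ge0 ?subr_ge0 ?mulr_ge0 ?(ltW la1) ?(ltW C1)
    //; lra.
  - move=> w hw'; rewrite -(ler_pM2l (x := 1 - la)) ?subr_gt0 // dotc.
    have := opt_cost_le_after hm true hw';
      have := opt_cost_le_after hm true (cone_step hm true hw').
    have := two w hw'; rewrite (one w); lra.
  - rewrite addr0 -(ler_pM2l (x := 1 - la)) ?subr_gt0 // dotc.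
    by have := two z hz; move: E2 E; rewrite -/s (one z); lra.
have := slope_offset hq hz hc.
have -> : slope c = - cost1 m.
  by rewrite /slope /c /=; field; rewrite subr_eq0 gt_eqF.
by have : 0 < cost1 m * - offset q z; [rewrite mulr_gt0 // oppr_gt0|lra].
Qed.

End Anticorrelated.

Section Alternation.
Context {R : realType}.
Implicit Types (m : search_model R) (c d z w : R * R) (i : bool) (q e s : R).

(** Exchanging the sites after each search turns the alternation of the two
    sites into repeated searches of site 1. *)
Definition swapped_step z m : R * R := swap (step m true z).

Lemma misplaced_next m q z : anticorrelated m -> maximal_belief m q ->
  misplaced m q z ->
  misplaced (swap_model m) (1 - q) (swapped_step z m).
Proof.
move=> hn hq hw; have [hz _ _] := hw; have hm := hn.1.
have hs := cone_step hm true hz; split; first exact: cone_swap.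
  by rewrite offset_swap oppr_lt0; exact: misplaced_crosses.
rewrite opt_cost_swap opt_cost_after_swap.
by case: (opt_cost_after_or hm hs) => // /(misplaced_no_repeat hn hq hw).
Qed.

Definition steep m e s z : Prop := forall c, tangent m e c z -> s <= slope c.

Lemma steep_next m q e s z : anticorrelated m -> misplaced m q z ->
  0 < s + slope_gain m ->
  steep m e s z -> steep (swap_model m) e (s + slope_gain m) (swapped_step z m).
Proof.
move=> hn [hz _ E] s0 H c /tangent_swap; rewrite swap_modelK swapK => hc.
have [c0 cd _] := hc; have hm := hn.1.
have h1 := H _ (tangent_prepend hm E hc); have h2 := slope_prepend hn c0 cd.
rewrite slope_swap in h2; have h3 := le_trans h1 h2.
have [/andP[a0 _] /andP[b0 _] _ _ _] := hm; have hb := hn.2.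
have h4 : s + slope_gain m <= (1 - stay1 m - stay2 m) * slope c by lra.
have [c1|c1] := leP 0 (slope c).
  have : 0 <= (stay1 m + stay2 m) * slope c by apply: mulr_ge0 => //; exact: addr_ge0.
  lra.
have : 0 <= (1 - stay1 m - stay2 m) * - slope c by apply: mulr_ge0; lra.
lra.
Qed.

(** A tangent of slope [s] is at least [s * z.1] at [z], since its cost from
    site 2 is nonnegative. *)
Lemma steep_mass m e s z : admissible m -> 0 < e -> cone z -> steep m e s z ->
  s * z.1 <= cost_bound m * mass z.
Proof.
move=> hm e0 hz H; apply: le_trans (opt_cost_le_bound hm hz).
apply/ler_addgt0Pr => d d0.
have d1 : 0 < Num.min d e by rewrite lt_min d0.
have [c [c0 cd ct]] := tangent_exists hm d1 hz.
have hc : tangent m e c z.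
  split=> //; apply: le_trans ct _; by rewrite lerD2l ge_min lexx orbT.
have h1 := H _ hc; have [z1 z2] := hz; have [c1 c2] := c0.
have : s * z.1 <= slope c * z.1 by rewrite ler_wpM2r.
have : Num.min d e <= d by rewrite ge_min lexx.
have : 0 <= c.2 * (z.1 + z.2) by rewrite mulr_ge0 ?addr_ge0.
by move: ct; rewrite /slope /dot; lra.
Qed.

(** Along the alternation, transporting one tangent back to [z] shows that the
    slopes grow by [slope_gain] at every search. *)
Lemma misplaced_steepens m q e z n : anticorrelated m -> maximal_belief m q ->
  misplaced m q z ->
  steep m e (- (slope_gain m / 2)) z ->
  exists2 w, misplaced m q w & steep m e (n%:R * slope_gain m - slope_gain m / 2) w.
Proof.
move=> hn hq hw hs; elim: n => [|n [w hw1 hs1]]; first by exists z;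
  rewrite // mul0r sub0r.
have k0 := slope_gain_gt0 hn.1.
have n0 : 0 <= n%:R * slope_gain m by rewrite mulr_ge0 // ltW.
have hn' := anticorrelated_swap hn; have hq' := maximal_belief_swap hq.
have hw2 := misplaced_next hn hq hw1.
have sp : 0 < n%:R * slope_gain m - slope_gain m / 2 + slope_gain m by lra.
have hs2 := steep_next hn hw1 sp hs1.
have sp' : 0 < n%:R * slope_gain m - slope_gain m / 2 + slope_gain m +
               slope_gain (swap_model m) by rewrite slope_gain_swap; lra.
have := misplaced_next hn' hq' hw2; have := steep_next hn' hw2 sp' hs2.
rewrite swap_modelK slope_gain_swap subKr => h3 h4.
exists (swapped_step (swapped_step w m) (swap_model m)); first exact: h4.
by move=> c hc; apply: le_trans (h3 c hc); rewrite -natr1; lra.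
Qed.

(** After a search of site 1 left of [q], site 2 keeps at least the mass
    [stay2 m * (1 - q)] per unit, while unbounded slopes force it to 0. *)
Lemma misplaced_stay2_eq0 m q z : anticorrelated m -> maximal_belief m q ->
  misplaced m q z ->
  stay2 m = 0.
Proof.
move=> hn hq hw; have hm := hn.1; have k0 := slope_gain_gt0 hm.
have [hz l0 E] := hw; have [/andP[q0 q1] _] := hq.
have [/andP[a0 a1] /andP[b0 b1] /andP[p0 p1] _ _] := hm.
have q_lt1 : q < 1.
  rewrite lt_def q1 andbT; apply/eqP => Q; have := misplaced_crosses hn hq hw.
  have [_ s2] := cone_step hm true hz; rewrite /offset -Q mul1r /mass.
  by move: s2; lra.
(* the initial slope may be slightly negative; one search makes it positive *)
pose e := slope_gain m / 2 * - offset q z.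
have e0 : 0 < e by rewrite mulr_gt0 ?divr_gt0 ?oppr_gt0.
have hs : steep m e (- (slope_gain m / 2)) z.
  move=> c hc; have := slope_offset hq hz hc; rewrite /e => h.
  by rewrite -(ler_pM2r (x := - offset q z)) ?oppr_gt0 //; lra.
apply/eqP; rewrite eq_le b0 andbT; set K := cost_bound (swap_model m).
have K0 : 0 < K := cost_bound_gt0 (admissible_swap hm).
suff : slope_gain m * (stay2 m * (1 - q)) <= 0.
  by rewrite pmulr_rle0 // pmulr_lle0 // subr_gt0.
apply: (@le0_of_natmul_bounded _ _ K) => n.
have [w hw1 hs1] := misplaced_steepens n hn hq hw hs.
have n0 : 0 <= n%:R * slope_gain m by rewrite mulr_ge0 // ltW.
have sp : 0 < n%:R * slope_gain m - slope_gain m / 2 + slope_gain m by lra.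
have hs2 := steep_next hn hw1 sp hs1.
have [hw0 lw Ew] := hw1; have [w1 w2] := hw0.
have hw2 := cone_swap (cone_step hm true hw0).
have M0 := offset_lt0_mass (proj1 hq) hw0 lw.
have := steep_mass (admissible_swap hm) e0 hw2 hs2; rewrite -/K mass_swap.
have h1 : stay2 m * (1 - q) * mass w <= (swapped_step w m).1.
  have : 0 <= stay2 m * - offset q w by rewrite mulr_ge0 // oppr_ge0 ltW.
  have : 0 <= (1 - stay1 m) * (overlook1 m * w.1) by rewrite !mulr_ge0 // subr_ge0.
  by rewrite /offset /mass /=; lra.
have h2 : K * mass (step m true w) <= K * mass w by rewrite ler_pM2l // mass_step.
move=> h3; rewrite -(ler_pM2r M0); apply: le_trans (le_trans h3 h2).
have -> : n%:R * (slope_gain m * (stay2 m * (1 - q))) * mass w =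
  n%:R * slope_gain m * (stay2 m * (1 - q) * mass w) by ring.
apply: ler_pM => //; last lra.
by rewrite !mulr_ge0 ?subr_ge0 // ltW.
Qed.

(** When the target changes site at every epoch, the alternation that starts
    with site 1 always misses a target that starts at site 2. *)
Lemma no_misplaced m q z : anticorrelated m -> maximal_belief m q -> ~ misplaced m q z.
Proof.
move=> hn hq hw; have hm := hn.1.
have hn' := anticorrelated_swap hn; have hq' := maximal_belief_swap hq.
have b0 := misplaced_stay2_eq0 hn hq hw.
have a0 : stay1 m = 0 := misplaced_stay2_eq0 hn' hq' (misplaced_next hn hq hw).
have [_ _ _ _ [C1 C2]] := hm.
have cost_n n w : misplaced m q w -> n%:R * (cost1 m * w.2) <= opt_cost m w.
  elim: n w => [|n IH] w hw1; first by rewrite mul0r; case: hw1 => ? _ _;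
    exact: opt_cost_ge0.
  have [hw0 lw E] := hw1; have hw2 := misplaced_next hn hq hw1.
  have [hs _ E2] := hw2; have hw3 := misplaced_next hn' hq' hw2.
  rewrite swap_modelK subKr in hw3.
  have := IH _ hw3.
  have -> : (swapped_step (swapped_step w m) (swap_model m)).2 = w.2.
    by rewrite /swapped_step /= a0 b0; ring.
  have -> : opt_cost m (swapped_step (swapped_step w m) (swap_model m)) =
            opt_cost (swap_model m) (step (swap_model m) true (swapped_step w m)).
    by rewrite -opt_cost_swap /swapped_step swapK.
  have M2 := cone_mass hs.
  move: E E2; rewrite /opt_cost_after -natr1 -(opt_cost_swap m (step m true w))
    -/(swapped_step w m) /= => -> -> h.
  have [w1 w2] := hw0.
  have : 0 <= cost2 m * mass (swapped_step w m) by rewrite mulr_ge0 // ltW.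
  have : 0 <= cost1 m * w.1 by rewrite mulr_ge0 // ltW.
  rewrite /mass; lra.
have [hz l0 _] := hw; have [z1 z2] := hz.
have := @le0_of_natmul_bounded _ _ _ (fun n => cost_n n z hw).
have M0 := offset_lt0_mass (proj1 hq) hz l0; have [/andP[_ q1] _] := hq.
rewrite pmulr_rle0 // leNgt => /negP; apply.
have : 0 <= (1 - q) * mass z by rewrite mulr_ge0 ?subr_ge0 // ltW.
by move: l0; rewrite /offset /mass; lra.
Qed.

Theorem anticorrelated_threshold m : anticorrelated m -> has_threshold m.
Proof.
move=> hn; have hm := hn.1; have [q q01 hq0] := opt_cost_max_exists hm.
have hq : maximal_belief m q by [].
exists q => // z hz; split=> lt.
  case: (opt_cost_after_or hm hz) => E; last by rewrite -E; exact: opt_cost_le_after.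
  by case: (@no_misplaced m q z hn hq); split=> //; rewrite subr_lt0.
case: (opt_cost_after_or hm hz) => E; first by rewrite -E; exact: opt_cost_le_after.
case: (@no_misplaced _ _ (swap z) (anticorrelated_swap hn) (maximal_belief_swap hq));
  split.
- exact: cone_swap.
- by rewrite offset_swap oppr_lt0 subr_gt0.
- by rewrite opt_cost_swap opt_cost_after_swap.
Qed.

End Alternation.

(** * The threshold when a + b > 1 *)

(** Monotonicity is a local property, for steps of uniform length. *)
Lemma chain_nonincreasing {R : realType} (f : R -> R) (x0 h : R) : 0 < h ->
  (forall x y, x0 <= x -> x < y -> y <= x + h -> f y <= f x) ->
  forall y, x0 <= y -> f y <= f x0.
Proof.
move=> h0 H y xy.
suff G n : forall y, x0 <= y -> y <= x0 + n%:R * h -> f y <= f x0.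
  have /archi_boundP : 0 <= (y - x0) / h by rewrite divr_ge0 ?subr_ge0 // ltW.
  rewrite ltr_pdivrMr // => lt; apply: (G _ _ xy); rewrite -lerBlDl; exact: ltW lt.
elim: n {y xy} => [|n IH] y xy yn.
  by have -> : y = x0 by apply/eqP; rewrite eq_le xy andbT; move: yn;
    rewrite mul0r addr0.
have [->//|yx] := eqVneq y x0.
have lt : x0 < y by rewrite lt_def yx.
pose x := Num.max x0 (y - h).
have x0x : x0 <= x by rewrite le_max lexx.
have xh : y <= x + h by rewrite -lerBlDr le_max lexx orbT.
have xlt : x < y by rewrite gt_max lt ltrBlDr ltrDl.
apply: le_trans (H _ _ x0x xlt xh) (IH _ x0x _).
have n0 : 0 <= n%:R * h by rewrite mulr_ge0 // ltW.
by rewrite ge_max lerDl n0 /=; move: yn; rewrite -natr1; lra.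
Qed.

Section Correlated.
Context {R : realType}.
Implicit Types (c d z w : R * R) (i : bool).

(** Minimisers of a linear form move monotonically with the form: higher odds
    of site 1 mean a lower cost from site 1 and a higher cost from site 2. *)
Lemma dot_exchange c d z w : cone z -> cone w -> z.1 * w.2 < w.1 * z.2 ->
  dot c z <= dot d z -> dot d w <= dot c w -> d.1 <= c.1 /\ c.2 <= d.2.
Proof.
move=> [z1 z2] [w1 w2] lt hz hw.
have k : 0 < w.1 * z.2 - z.1 * w.2 by rewrite subr_gt0.
have a1 : 0 <= z.2 * (dot c w - dot d w) by rewrite mulr_ge0 // subr_ge0.
have a2 : 0 <= w.2 * (dot d z - dot c z) by rewrite mulr_ge0 // subr_ge0.
have a3 : 0 <= z.1 * (dot c w - dot d w) by rewrite mulr_ge0 // subr_ge0.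
have a4 : 0 <= w.1 * (dot d z - dot c z) by rewrite mulr_ge0 // subr_ge0.
move: a1 a2 a3 a4; rewrite /dot => a1 a2 a3 a4; split.
  by rewrite -subr_ge0 -(pmulr_rge0 _ k); lra.
by rewrite -subr_ge0 -(pmulr_rge0 _ k); lra.
Qed.

Variable m : search_model R.
Hypothesis hm : admissible m.
Hypothesis hpos : 1 < stay1 m + stay2 m.
Hypothesis hcheap : cost1 m <= cost2 m.

Local Notation vec := (plan_cost m 0).
Local Notation dvec s := (dual_drift m (plan_cost m 0 s)).

(** The odds of site 1 are higher at [w] than at [z], by a factor less than
    1 / (overlook1 * overlook2), which is the ratio of the odds after a search of
    site 2 and after a search of site 1.  Both inequalities are strict: with equal
    odds, ties between optimal plans would break the comparison. *)
Definition between z w : Prop :=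
  z.1 * w.2 < w.1 * z.2 /\ overlook1 m * overlook2 m * (w.1 * z.2) < z.1 * w.2.

(** [(vec s).1] and [(vec t).1] are derivatives, in the mass at site 1, of
    the [n]-step cost at [z] and [w]; the bound is the sign of the derivative of
    [advantage] at the next horizon. *)
Definition gap_bounded n : Prop := forall z w s t, cone z -> cone w -> between z w ->
  optimal_plan m n s z -> optimal_plan m n t w ->
  overlook1 m * (vec s).1 - (vec t).1 <= cost2 m - cost1 m.

Lemma optimal_plan_le n s t z w : optimal_plan m n s z -> optimal_plan m n t w ->
  dot (vec s) z <= dot (vec t) z.
Proof. by move=> [_ ->] [<- _]; exact: horizon_le_plan. Qed.

Lemma optimal_dual_drift_le n s t z w : optimal_plan m n s (drift m z) ->
  optimal_plan m n t (drift m w) -> dot (dvec s) z <= dot (dvec t) z.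
Proof. by rewrite !dot_dual_drift; exact: optimal_plan_le. Qed.

(** The move preserves the order of the odds because its determinant is positive
    and contracts their ratio because its entries are nonnegative. *)
Lemma between_drift z w : cone z -> cone w -> between z w ->
  between (drift m z) (drift m w).
Proof.
have [/andP[a0 a1] /andP[b0 b1] /andP[p0 p1] /andP[r0 r1] _] := hm.
have hp := hpos; have a_gt0 : 0 < stay1 m by lra.
have b_gt0 : 0 < stay2 m by lra.
move=> [z1 z2] [w1 w2] [h1 h2].
pose al := overlook1 m * overlook2 m.
have al1 : al <= 1 by rewrite mulr_ile1 // ltW.
split.
  rewrite -subr_gt0.
  have -> : (drift m w).1 * (drift m z).2 - (drift m z).1 * (drift m w).2 =
     (stay1 m + stay2 m - 1) * (w.1 * z.2 - z.1 * w.2) by rewrite /=; ring.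
  by rewrite mulr_gt0 // subr_gt0.
rewrite -subr_gt0 -/al.
have -> : (drift m z).1 * (drift m w).2 - al * ((drift m w).1 * (drift m z).2) =
   stay1 m * (1 - stay1 m) * (z.1 * w.1) * (1 - al)
   + stay2 m * (1 - stay2 m) * (z.2 * w.2) * (1 - al)
   + stay1 m * stay2 m * (z.1 * w.2 - al * (w.1 * z.2))
   + (1 - stay1 m) * (1 - stay2 m) * (w.1 * z.2 - al * (z.1 * w.2)).
  by rewrite /=; ring.
have e1 : 0 <= stay1 m * (1 - stay1 m) * (z.1 * w.1) * (1 - al).
  by rewrite !mulr_ge0 // subr_ge0.
have e2 : 0 <= stay2 m * (1 - stay2 m) * (z.2 * w.2) * (1 - al).
  by rewrite !mulr_ge0 // subr_ge0.
have e3 : 0 < stay1 m * stay2 m * (z.1 * w.2 - al * (w.1 * z.2)).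
  by apply: mulr_gt0; [exact: mulr_gt0|rewrite subr_gt0].
have e4 : 0 <= (1 - stay1 m) * (1 - stay2 m) * (w.1 * z.2 - al * (z.1 * w.2)).
  rewrite !mulr_ge0 ?subr_ge0 //; apply: le_trans (ltW h1).
  by rewrite ler_piMl // mulr_ge0.
lra.
Qed.

(** The move averages the bound at site 1 with the inequality of the costs from
    site 2, which needs no constant; multiplying [cost2 m - cost1 m] by a weight
    keeps the bound because this difference is nonnegative. *)
Lemma gap_dual_drift n z w s t : gap_bounded n -> cone z -> cone w -> between z w ->
  optimal_plan m n s (drift m z) -> optimal_plan m n t (drift m w) ->
  overlook1 m * (dvec s).1 - (dvec t).1 <= cost2 m - cost1 m.
Proof.
move=> Q hz hw hb hs ht.
have hz' := cone_drift hm hz; have hw' := cone_drift hm hw.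
have hb' := between_drift hz hw hb.
have q := Q _ _ _ _ hz' hw' hb' hs ht.
have [_ y] := dot_exchange hz' hw' hb'.1 (optimal_plan_le hs ht) (optimal_plan_le ht
  hs).
have [/andP[a0 a1] _ /andP[p0 p1] _ _] := hm.
have [_ ys] := cone_plan hm s (lexx 0).
have y' : overlook1 m * (vec s).2 <= (vec t).2.
  by apply: le_trans y; rewrite ler_piMl // ltW.
have : stay1 m * (overlook1 m * (vec s).1 - (vec t).1) <= stay1 m * (cost2 m - cost1 m).
  by rewrite ler_wpM2l.
have : (1 - stay1 m) * (overlook1 m * (vec s).2) <= (1 - stay1 m) * (vec t).2.
  by rewrite ler_wpM2l // subr_ge0.
have : stay1 m * (cost2 m - cost1 m) <= cost2 m - cost1 m.
  by rewrite ler_piMl // subr_ge0.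
rewrite /=; lra.
Qed.

Definition advantage n z : R :=
  horizon_cost_after m n true z - horizon_cost_after m n false z.

(** Linear bounds by optimal plans at [u] and [v] compare their slopes at odds
    whose ratio slightly exceeds the one allowed by [between].  Adding [eta] to
    the mass at site 2 in one of the two terms makes room for this, and [eta]
    tends to 0 at the end. *)
Lemma advantage_le_pos n x x' y : gap_bounded n -> 0 < x -> x <= x' -> 0 < y ->
  advantage n (x', y) <= advantage n (x, y).
Proof.
move=> Q x0 xx y0.
have [_ _ /andP[p0 p1] /andP[r0 r1] _] := hm.
set al := overlook1 m in p0 p1; set be := overlook2 m in r0 r1.
have x'0 : 0 < x' by exact: lt_le_trans xx.
have [t0 ht0] := optimal_plan_exists m n (drift m (x', be * y)).
have [_ B0] := cone_dual_drift hm (cone_plan hm t0 (lexx 0));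
  set B := (dvec t0).2 in B0.
have ab1 : al * be < 1.
  by apply: le_lt_trans r1; rewrite ler_piMl // ltW.
apply/ler_addgt0Pr => e e0.
pose eta := Num.min (e / (B + 1)) (y * (1 - al * be) / 2).
have eta0 : 0 < eta.
  rewrite lt_min; apply/andP; split; first by rewrite divr_gt0 // ltr_wpDl.
  by rewrite divr_gt0 // mulr_gt0 // subr_gt0.
have eta1 : eta * B <= e.
  have : eta <= e / (B + 1) by rewrite ge_min lexx.
  rewrite ler_pdivlMr ?ltr_wpDl //; lra.
have eta2 : al * (be * y + eta) < y.
  have h : eta <= y * (1 - al * be) / 2 by rewrite ge_min lexx orbT.
  have : al * eta <= eta by rewrite ler_piMl // ltW.
  have : 0 < y * (1 - al * be) by rewrite mulr_gt0 // subr_gt0.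
  lra.
pose f u := (cost1 m - cost2 m) * u + horizon_cost m n (drift m (al * u, y))
            - horizon_cost m n (drift m (u, be * y + eta)).
pose h := x * eta / (be * y + 1).
have by0 : 0 <= be * y by rewrite mulr_ge0 // ltW.
have h0 : 0 < h by rewrite divr_gt0 ?mulr_gt0 // ltr_wpDl.
have hh : be * y * h < x * eta.
  have : h * (be * y + 1) = x * eta by rewrite divfK // gt_eqF // ltr_wpDl.
  lra.
have step_le u v : x <= u -> u < v -> v <= u + h -> f v <= f u.
  move=> xu uv vh; have u0 : 0 < u by exact: lt_le_trans xu.
  have v0 : 0 < v by exact: lt_trans uv.
  have [s hs] := optimal_plan_exists m n (drift m (al * u, y)).
  have [t ht] := optimal_plan_exists m n (drift m (v, be * y + eta)).
  have g : al * (dvec s).1 - (dvec t).1 <= cost2 m - cost1 m.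
    have [/esym aE|an0] := eqVneq 0 al.
      have [k _] := cone_dual_drift hm (cone_plan hm t (lexx 0)).
      by rewrite aE mul0r sub0r; apply: le_trans (_ : _ <= 0) _;
        rewrite ?oppr_le0 ?subr_ge0.
    have a0 : 0 < al by rewrite lt_def eq_sym an0.
    apply: (@gap_dual_drift n (al * u, y) (v, be * y + eta)) => //.
    - by split; rewrite /= ?mulr_ge0 ?(ltW u0) ?(ltW y0).
    - by split; rewrite /= ?addr_ge0 ?(ltW v0) ?(ltW eta0).
    - split=> /=; rewrite -/al -/be.
        have k1 : u * (al * (be * y + eta)) < u * y by rewrite ltr_pM2l.
        have k2 : u * y < v * y by rewrite ltr_pM2r.
        lra.
      have k1 : be * y * v <= be * y * (u + h) by rewrite ler_wpM2l.
      have k2 : x * eta <= u * eta by rewrite ler_pM2r.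
      have : al * (be * y * v) < al * (u * (be * y + eta)) by rewrite ltr_pM2l //; lra.
      lra.
  have e1 := horizon_le_plan m s (drift m (al * v, y)); rewrite hs.1 in e1.
  have e2 := horizon_le_plan m t (drift m (u, be * y + eta)); rewrite ht.1 in e2.
  have e3 := hs.2; have e4 := ht.2; rewrite -!dot_dual_drift in e1 e2 e3 e4.
  have : (al * (dvec s).1 - (dvec t).1) * (v - u) <= (cost2 m - cost1 m) * (v - u).
    by rewrite ler_wpM2r // subr_ge0 ltW.
  move: e1 e2 e3 e4; rewrite /f /dot; case: (dvec s) => g1 g2; case: (dvec t) => k1 k2.
  rewrite [fst (g1, _)]/= [snd (g1, _)]/= [fst (k1, _)]/= [snd (k1, _)]/=.
  rewrite [fst (al * v, y)]/= [fst (al * u, y)]/= [snd (al * v, y)]/= [snd (al * u,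
    y)]/=.
  rewrite [fst (u, _)]/= [snd (u, _)]/= [fst (v, _)]/= [snd (v, _)]/=.
  lra.
have fx := chain_nonincreasing h0 step_le xx.
have e1 := horizon_le_plan m t0 (drift m (x', be * y + eta)); rewrite ht0.1 in e1.
have e2 := ht0.2; rewrite -!dot_dual_drift in e1 e2.
have e3 : horizon_cost m n (drift m (x, be * y)) <=
  horizon_cost m n (drift m (x, be * y + eta)).
  have [/andP[a0 a1] /andP[b0 b1] _ _ _] := hm.
  apply: (horizon_le hm) => /=.
  - by apply: cone_drift => //; split; rewrite //= ltW.
  - by rewrite lerD2l ler_wpM2l ?subr_ge0 // lerDl ltW.
  - by rewrite lerD2l ler_wpM2l // lerDl ltW.
have A u : advantage n (u, y) = (cost1 m - cost2 m) * (u + y) +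
    horizon_cost m n (drift m (al * u, y)) - horizon_cost m n (drift m (u, be * y)).
  by rewrite /advantage /horizon_cost_after /step /mass /=; ring.
rewrite !A; move: fx e1 e2; rewrite /f /dot -/B.
rewrite [fst (x', _)]/= [snd (x', _)]/= [fst (x', _)]/= [snd (x', _)]/=; lra.
Qed.

Lemma advantageZ n t z : 0 < t -> advantage n (t * z.1, t * z.2) = t * advantage n z.
Proof.
move=> t0; have E i : horizon_cost_after m n i (t * z.1, t * z.2) =
  t * horizon_cost_after m n i z.
  rewrite /horizon_cost_after [RHS]mulrDr -(horizonZ m n _ (ltW t0));
    congr (_ + horizon_cost m n _).
    by rewrite /mass /=; ring.
  by case: i; rewrite /step /drift /=; congr (_, _); ring.
by rewrite /advantage !E mulrBr.
Qed.

Lemma advantage_le0 n z w : gap_bounded n -> 0 < z.1 -> 0 < z.2 -> 0 < w.2 ->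
  z.1 * w.2 <= w.1 * z.2 -> advantage n z <= 0 -> advantage n w <= 0.
Proof.
move=> Q z1 z2 w2 le h; have t0 : 0 < z.2 / w.2 by rewrite divr_gt0.
rewrite -(pmulr_rle0 _ t0) -(advantageZ n w t0) divfK ?gt_eqF //.
apply: le_trans h; rewrite [in leRHS](surjective_pairing z).
by apply: advantage_le_pos => //; rewrite mulrAC ler_pdivlMr // [leRHS]mulrC.
Qed.

(** If both plans start with the same search, strip it.  If the plan at the lower
    odds starts with 2 and the other with 1, the odds after the searches are in
    reverse order, and the monotonicity of costs suffices.  If they start with 1
    and 2, then 1 is also optimal slightly above [w] by [advantage_le0], and the
    plan [t] can be replaced by one that starts with 1: its cost from site 1 is
    lower, which only strengthens the bound. *)
Lemma gap_boundedS n : gap_bounded n -> gap_bounded n.+1.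
Proof.
move=> Q z w s t hz hw hb hs ht.
have [_ _ /andP[p0 p1] /andP[r0 r1] [C1 C2]] := hm.
have X0 s' : 0 <= (vec s').1 by have [] := cone_plan hm s' (lexx 0).
have [/esym aE|an0] := eqVneq 0 (overlook1 m).
  rewrite aE mul0r sub0r; apply: le_trans (_ : _ <= 0) _; last by rewrite subr_ge0.
  by rewrite oppr_le0.
have a0 : 0 < overlook1 m by rewrite lt_def eq_sym an0.
have [z1 z2] := hz; have [w1 w2] := hw; have [b1 b2] := hb.
have [zw1 wz1] : 0 < z.1 * w.2 /\ 0 < w.1 * z.2.
  have h : 0 < z.1 * w.2 by apply: le_lt_trans b2; rewrite !mulr_ge0.
  by split=> //; exact: lt_trans b1.
have z1' : 0 < z.1 by rewrite lt_def z1 andbT; apply/eqP => H; move: zw1;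
  rewrite H mul0r ltxx.
have w2' : 0 < w.2 by rewrite lt_def w2 andbT; apply/eqP => H; move: zw1;
  rewrite H mulr0 ltxx.
have z2' : 0 < z.2 by rewrite lt_def z2 andbT; apply/eqP => H; move: wz1;
  rewrite H mulr0 ltxx.
have dl0 : 0 <= cost2 m - cost1 m by rewrite subr_ge0.
have both1 v s' t' : cone v -> between z v -> optimal_plan m n.+1 (true :: s') z ->
    optimal_plan m n.+1 (true :: t') v ->
    overlook1 m * (vec (true :: s')).1 - (vec (true :: t')).1 <= cost2 m - cost1 m.
  move=> hv [c1 c2] /optimal_plan_uncons[hs' _] /optimal_plan_uncons[ht' _].
  have g : overlook1 m * (dvec s').1 - (dvec t').1 <= cost2 m - cost1 m.
    apply: (gap_dual_drift Q _ _ _ hs' ht'); try exact: (cone_survive hm true).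
    split=> /=.
      have : overlook1 m * (z.1 * v.2) < overlook1 m * (v.1 * z.2) by rewrite ltr_pM2l.
      lra.
    have : overlook1 m * (overlook1 m * overlook2 m * (v.1 * z.2)) <
           overlook1 m * (z.1 * v.2) by rewrite ltr_pM2l.
    lra.
  have g' : overlook1 m * (overlook1 m * (dvec s').1 - (dvec t').1) <=
            overlook1 m * (cost2 m - cost1 m) by rewrite ler_wpM2l.
  have g'' : overlook1 m * (cost2 m - cost1 m) <=
    cost2 m - cost1 m by rewrite ler_piMl // ltW.
  have : overlook1 m * cost1 m <= cost1 m by rewrite ler_piMl // ltW.
  move: g'; rewrite !plan_cost_cons /prepend; case: (dvec s') => ? ?;
    case: (dvec t') => ? ? /=; lra.
case: s hs => [|i s'] hs; first by case: hs.
case: t ht => [|j t'] ht; first by case: ht.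
have [hs' Es] := optimal_plan_uncons hs; have [ht' Et] := optimal_plan_uncons ht.
case: i j hs ht hs' ht' Es Et => [] [] hs ht hs' ht' Es Et.
- exact: (both1 w _ _ hw hb hs ht).
- (* half of the room left by [between] *)
  pose eta := (z.1 * w.2 - overlook1 m * overlook2 m * (w.1 * z.2)) / (2 * z.2).
  have eta0 : 0 < eta by rewrite divr_gt0 ?subr_gt0 // mulr_gt0.
  have etaE : eta * (2 * z.2) = z.1 * w.2 - overlook1 m * overlook2 m * (w.1 * z.2).
    by rewrite divfK // mulf_neq0 // gt_eqF.
  pose v := (w.1 + eta, w.2).
  have hv : cone v by split; rewrite //= addr_ge0 // ltW.
  have ez : 0 < eta * z.2 by rewrite mulr_gt0.
  have zv : between z v.
    split=> /=; first by move: b1; rewrite mulrDl; lra.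
    have : overlook1 m * overlook2 m * (eta * z.2) <= eta * z.2.
      by rewrite ler_piMl ?(ltW ez) // mulr_ile1 // ltW.
    lra.
  have adv : advantage n v <= 0.
    apply: (advantage_le0 Q z1' z2') => //; first exact: (ltW zv.1).
    by rewrite subr_le0 -Es; exact: horizonS_le.
  have Ev : horizon_cost m n.+1 v = horizon_cost_after m n true v.
    by rewrite horizonS min_l //; rewrite subr_le0 in adv.
  have [u hu] := optimal_plan_exists m n (step m true v).
  have hu' := optimal_plan_cons hu Ev.
  have wv : w.1 * v.2 < v.1 * w.2 by rewrite /= ltr_pM2r // ltrDl.
  have [x _] := dot_exchange hw hv wv (optimal_plan_le ht hu') (optimal_plan_le hu' ht).
  apply: le_trans (both1 _ _ _ hv zv hs hu'); rewrite lerD2l lerN2; exact: x.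
- have hz' : cone (survive m false z) by exact: cone_survive.
  have hw' : cone (survive m true w) by exact: cone_survive.
  have lt : (survive m true w).1 * (survive m false z).2 <
            (survive m false z).1 * (survive m true w).2 by rewrite /=; lra.
  have [x _] := dot_exchange hw' hz' lt (optimal_dual_drift_le ht' hs')
    (optimal_dual_drift_le hs' ht').
  have g : overlook1 m * (dvec s').1 <= overlook1 m * (dvec t').1 by rewrite ler_wpM2l.
  have : overlook1 m * cost2 m <= cost2 m by rewrite ler_piMl // ltW.
  move: g; rewrite !plan_cost_cons /prepend; case: (dvec s') => ? ?;
    case: (dvec t') => ? ? /=; lra.
- have g : overlook1 m * (dvec s').1 - (dvec t').1 <= cost2 m - cost1 m.
    (* a perfect search of site 2 leaves the same odds at [z] and [w] *)
    have [/esym rE|rn0] := eqVneq 0 (overlook2 m).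
      have := optimal_dual_drift_le hs' ht'.
      rewrite /dot /= rE mul0r !mulr0 !addr0 ler_pM2r // => h.
      apply: le_trans dl0; rewrite subr_le0; apply: le_trans h.
      by apply: ler_piMl; [have [] :=
        cone_dual_drift hm (cone_plan hm s' (lexx 0))|exact: ltW].
    have rp : 0 < overlook2 m by rewrite lt_def eq_sym rn0.
    apply: (gap_dual_drift Q _ _ _ hs' ht'); try exact: (cone_survive hm false).
    split=> /=.
      have : overlook2 m * (z.1 * w.2) < overlook2 m * (w.1 * z.2) by rewrite ltr_pM2l.
      lra.
    have : overlook2 m * (overlook1 m * overlook2 m * (w.1 * z.2)) <
           overlook2 m * (z.1 * w.2) by rewrite ltr_pM2l.
    lra.
  have : overlook1 m * cost2 m <= cost2 m by rewrite ler_piMl // ltW.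
  move: g; rewrite !plan_cost_cons /prepend; case: (dvec s') => ? ?;
    case: (dvec t') => ? ? /=; lra.
Qed.

Lemma gap_boundedP n : gap_bounded n.
Proof.
elim: n => [|n]; last exact: gap_boundedS.
move=> z w s t _ _ _ [/size0nil -> _] [/size0nil -> _].
by rewrite /= mulr0 subr0 subr_ge0.
Qed.

Lemma advantage_le n x x' y : 0 <= x -> x <= x' -> 0 < y ->
  advantage n (x', y) <= advantage n (x, y).
Proof.
move=> x0 xx y0; have Q : gap_bounded n by exact: gap_boundedP.
(* at [x = 0] the odds vanish and cannot be compared; use small [x > 0] *)
move: x0; rewrite le_eqVlt => /orP[/eqP x0|x0]; last exact: advantage_le_pos.
rewrite -x0 {x x0 xx} in xx *.
have [->//|x'n] := eqVneq x' 0.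
have x'0 : 0 < x' by rewrite lt_def x'n.
have [s hs] := optimal_plan_exists m n (step m true (0, y)).
have [g0 _] := cone_dual_drift hm (cone_plan hm s (lexx 0)).
have [_ _ /andP[p0 p1] _ _] := hm.
set B := overlook1 m * (dvec s).1.
have B0 : 0 <= B by rewrite mulr_ge0.
apply/ler_addgt0Pr => e e0.
pose x := Num.min x' (e / (B + 1)).
have x0 : 0 < x by rewrite lt_min x'0 divr_gt0 // ltr_wpDl.
have xB : x * B <= e.
  have : x <= e / (B + 1) by rewrite ge_min lexx orbT.
  rewrite ler_pdivlMr ?ltr_wpDl //; lra.
apply: le_trans (advantage_le_pos Q x0 _ y0) _; first by rewrite ge_min lexx.
have e1 := horizon_le_plan m s (step m true (x, y)); rewrite hs.1 in e1.
have e2 := hs.2; rewrite -!dot_dual_drift in e1 e2.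
have e3 : horizon_cost m n (step m false (0, y)) <=
  horizon_cost m n (step m false (x, y)).
  have [/andP[a0 a1] /andP[b0 b1] _ _ _] := hm.
  apply: (horizon_le hm) => /=.
  - by apply: cone_step => //; split; rewrite //= ltW.
  - by rewrite lerD2r ler_wpM2l // ltW.
  - by rewrite lerD2r ler_wpM2l ?subr_ge0 // ltW.
have e4 : (cost1 m - cost2 m) * x <= 0 by rewrite mulr_le0_ge0 ?subr_le0 // ltW.
move: xB e1 e2 e3 e4; rewrite /B /advantage /horizon_cost_after /dot.
move: (dvec s) => g; rewrite [survive _ _ _]/= [survive _ _ _]/=.
rewrite /mass [search_cost _ _]/= [search_cost _ _]/= [fst (x, _)]/= [snd (x, _)]/=.
rewrite [fst (0, _)]/= [snd (0, _)]/= [fst (_ * x, _)]/= [snd (_ * x, _)]/=.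
rewrite [fst (_ * 0, _)]/= [snd (_ * 0, _)]/=; lra.
Qed.

Definition opt_advantage z : R := opt_cost_after m true z - opt_cost_after m false z.

Lemma opt_advantage_le x x' y : 0 <= x -> x <= x' -> 0 < y ->
  opt_advantage (x', y) <= opt_advantage (x, y).
Proof.
move=> x0 xx y0; apply/ler_addgt0Pr => e e0.
have hx : cone (x, y) by split; rewrite //= ltW.
have hx' : cone (x', y) by split=> /=; [exact: le_trans xx|exact: ltW].
have [n Hn] := horizon_close hm (x' + y) (divr_gt0 e0 (ltr0n R 2)).
have h1 i : opt_cost m (step m i (x', y)) - horizon_cost m n (step m i (x', y)) <=
  e / 2.
  apply: (Hn _ _ _).1; first exact: cone_step.
  exact: (mass_step hm i hx').
have h2 i : opt_cost m (step m i (x, y)) - horizon_cost m n (step m i (x, y)) <= e / 2.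
  apply: (Hn _ _ _).1; first exact: cone_step.
  by apply: le_trans (mass_step hm i hx) _; rewrite /mass lerD2r.
have k1 := horizon_le_opt_cost hm n (cone_step hm false hx').
have k2 := horizon_le_opt_cost hm n (cone_step hm true hx).
have := advantage_le n x0 xx y0.
have := h1 true; have := h2 false.
rewrite /advantage /opt_advantage /horizon_cost_after /opt_cost_after; lra.
Qed.

Lemma opt_advantageZ t z : cone z -> 0 <= t ->
  opt_advantage (t * z.1, t * z.2) = t * opt_advantage z.
Proof.
by move=> hz t0; rewrite /opt_advantage !opt_cost_afterZ // mulrBr.
Qed.

Lemma opt_advantage_site1 : opt_advantage (1, 0) <= 0.
Proof.
have [/andP[a0 a1] _ /andP[p0 p1] _ _] := hm.
have h : cone (stay1 m, 1 - stay1 m) by split; rewrite //= subr_ge0.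
rewrite subr_le0 /opt_cost_after /mass /= !addr0 !mulr1; apply: lerD => //.
have -> : step m true (1, 0) = (overlook1 m * stay1 m, overlook1 m * (1 - stay1 m)).
  by rewrite /step /drift /=; congr (_, _); ring.
have -> : step m false (1, 0) = (stay1 m, 1 - stay1 m).
  by rewrite /step /drift /=; congr (_, _); ring.
by rewrite (opt_costZ hm h p0) ler_piMl ?opt_cost_ge0 // ltW.
Qed.

Theorem correlated_threshold : has_threshold m.
Proof.
pose A : set R := [set p | p = 0 \/ (0 <= p <= 1 /\ 0 < opt_advantage (p, 1 - p))].
have ubA : ubound A 1 by move=> p [->|[/andP[]]].
have hsA : has_sup A by split; [exists 0; left|exists 1].
have q0 : 0 <= sup A by apply: ub_le_sup; [exists 1|left].
have q1 : sup A <= 1 by apply: ge_sup => //; exists 0; left.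
exists (sup A); first by rewrite q0.
move=> z hz; have [z1 z2] := hz; split=> lt; [rewrite -subr_ge0|rewrite -subr_le0];
  last first.
  have M0 : 0 < mass z.
    rewrite lt_def cone_mass // andbT; apply/eqP => M; move: lt; rewrite M mulr0.
    by move: M; rewrite /mass; lra.
  pose p := z.1 / mass z.
  have Ep1 : mass z * p = z.1 by rewrite mulrC divfK // gt_eqF.
  have Ep2 : mass z * (1 - p) = z.2 by rewrite mulrBr mulr1 Ep1 /mass; ring.
  have p0 : 0 <= p by rewrite divr_ge0 // ltW.
  have p1 : 0 <= 1 - p by rewrite -(pmulr_rge0 _ M0) Ep2.
  have -> : opt_cost_after m true z - opt_cost_after m false z =
    mass z * opt_advantage (p, 1 - p).
    rewrite -(opt_advantageZ (z := (p, 1 - p)) _ (ltW M0)) //.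
    by rewrite [fst (p, _)]/= [snd (p, _)]/= Ep1 Ep2 -surjective_pairing.
  rewrite pmulr_rle0 //.
  rewrite leNgt; apply/negP => h.
  have : p <= sup A by apply: ub_le_sup; [exists 1|right; rewrite p0 -subr_ge0].
  by rewrite -(ler_pM2l M0) Ep1 mulrC leNgt lt.
have M0 : 0 < mass z.
  rewrite lt_def cone_mass // andbT; apply/eqP => M; move: lt; rewrite M mulr0.
  by rewrite ltNge z1.
have lt' : z.1 / mass z < sup A by rewrite ltr_pdivrMr.
have [p Ap pz] := sup_gt hsA.1 lt'.
have z0 : 0 <= z.1 / mass z by rewrite divr_ge0 // ltW.
case: Ap => [p0|[/andP[p0 p1] h]]; first by move: pz; rewrite p0 ltNge z0.
have pn1 : p < 1.
  rewrite lt_def p1 andbT; apply/eqP => P; move: h; rewrite -P subrr.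
  by rewrite ltNge opt_advantage_site1.
rewrite ltr_pdivrMr // in pz.
have zp : z.1 * (1 - p) <= p * z.2 by move: pz; rewrite /mass; lra.
have z2' : 0 < z.2.
  rewrite lt_def z2 andbT; apply/eqP => Z; move: pz; rewrite /mass Z addr0.
  have : p * z.1 <= z.1 by rewrite ler_piMl.
  lra.
have lt0 : 0 < z.2 / (1 - p) by rewrite divr_gt0 // subr_gt0.
have h2 : 0 < opt_advantage (z.2 / (1 - p) * p, z.2).
  have -> : (z.2 / (1 - p) * p, z.2) =
      (z.2 / (1 - p) * (p, 1 - p).1, z.2 / (1 - p) * (p, 1 - p).2).
    by rewrite /= divfK // gt_eqF // subr_gt0.
  rewrite opt_advantageZ ?(ltW lt0) //; first exact: mulr_gt0.
  by split; rewrite //= subr_ge0.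
rewrite -/(opt_advantage z); apply: le_trans (ltW h2) _.
rewrite [in leRHS](surjective_pairing z); apply: opt_advantage_le => //.
by rewrite mulrAC ler_pdivlMr ?subr_gt0 // [z.2 * p]mulrC.
Qed.

End Correlated.

Theorem admissible_threshold {R : realType} (m : search_model R) : admissible m ->
  has_threshold m.
Proof.
move=> hm; have [h|h] := leP (stay1 m + stay2 m) 1;
  first exact: anticorrelated_threshold.
have [c|/ltW c] := leP (cost1 m) (cost2 m); first exact: correlated_threshold.
apply: has_threshold_swap; apply: correlated_threshold => //=;
  first exact: admissible_swap.
by rewrite addrC.
Qed.

(** * Expected cost of a policy *)

Section Exhaustion.
Context {R : realType} {T : choiceType}.
Variable f : T -> \bar R.

Lemma big_seq_le_esum (l : seq T) : uniq l ->
  (\sum_(t <- l) f t <= \esum_(t in [set: T]) f t)%E.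
Proof.
move=> ul; apply: esum_ge; exists [set` l]; last by rewrite fsbig_seq.
by split=> //; exact: finite_seq.
Qed.

(** Every finite set lies in some [l n]. *)
Lemma esum_le_exhaustion (l : nat -> seq T) (B : \bar R) :
  (forall t, (0 <= f t)%E) -> (forall n, uniq (l n)) ->
  (forall n, {subset l n <= l n.+1}) -> (forall t, exists n, t \in l n) ->
  (forall n, (\sum_(t <- l n) f t <= B)%E) -> (\esum_(t in [set: T]) f t <= B)%E.
Proof.
move=> f0 ul sl el H; apply: ge_ereal_sup => _ [X [/finite_seqP[s ->] _] <-].
have sub n k : {subset l n <= l (k + n)%N}.
  by elim: k => // k IH t /IH; rewrite addSn; exact: sl.
have [n sn] : exists n, {subset s <= l n}.
  elim: s => [|t s [n sn]]; first by exists 0%N.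
  have [k tk] := el t; exists (k + n)%N => u; rewrite inE => /orP[/eqP ->|/sn].
    by rewrite addnC; exact: sub.
  exact: sub.
apply: le_trans (H n); rewrite (fsbig_seq _ _ (ul n));
  apply: lee_fsum_nneg_subset => [||t|t _].
- exact: finite_seq.
- exact: finite_seq.
- by rewrite !inE /=; exact: sn.
- exact: f0.
Qed.

End Exhaustion.

Definition epochs : seq (bool * bool) :=
  [:: (true, true); (false, true); (true, false); (false, false)].

Fixpoint paths (n : nat) : seq detected_path :=
  [::] :: (if n is n'.+1 then [seq e :: w | e <- epochs, w <- paths n'] else [::]).

Lemma pathsS n : paths n.+1 = [::] :: [seq e :: w | e <- epochs, w <- paths n].
Proof. by []. Qed.

Lemma mem_paths n w : (w \in paths n) = (size w <= n)%N.
Proof.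
elim: n w => [|n IH] w; first by rewrite mem_seq1; case: w.
rewrite pathsS in_cons; case: w => [|e w] //.
rewrite [_ == _]/= orFb; apply/allpairsP/idP => [[[e' w'] /= [_ + [_ ->]]]|h].
  by rewrite IH.
by exists (e, w); rewrite IH; split=> //=; case: (e) => -[] [].
Qed.

Lemma uniq_paths n : uniq (paths n).
Proof.
elim: n => // n IH; rewrite pathsS cons_uniq; apply/andP; split.
  by apply/allpairsP => -[[? ?] []].
by apply: allpairs_uniq => // -[? ?] [? ?] _ _ [-> ->].
Qed.

Section Run.
Context {R : realType}.
Variable m : search_model R.
Hypothesis hm : admissible m.
Variable d : seq bool -> R.
Hypothesis hd : forall h, 0 <= d h <= 1.
Implicit Types (h : seq bool) (z : R * R) (i : bool) (w : detected_path).

(** Unnormalised laws of the site, in the form that [detected_prob] expects. *)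
Definition law z : bool -> R := fun x => if x then z.1 else z.2.

Definition path_search_cost w : R := \sum_(e <- w) search_cost m e.2.

Definition mean (x1 x2 : R) h : R := d h * x1 + (1 - d h) * x2.

Lemma le_mean x1 x2 y1 y2 h : x1 <= y1 -> x2 <= y2 -> mean x1 x2 h <= mean y1 y2 h.
Proof.
by have /andP[d0 d1] := hd h => ? ?; rewrite lerD // ler_wpM2l // subr_ge0.
Qed.

Fixpoint undetected n h z : R :=
  if n is n'.+1 then mean (undetected n' (rcons h true) (step m true z))
                          (undetected n' (rcons h false) (step m false z)) h
  else mass z.

(** Expected cost up to epoch [n] or detection, whichever comes first. *)
Fixpoint spent n h z : R :=
  if n is n'.+1 then
    mean (cost1 m * mass z + spent n' (rcons h true) (step m true z))
         (cost2 m * mass z + spent n' (rcons h false) (step m false z)) h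
  else 0.

Lemma detected_prob_ge0 h z w : cone z -> 0 <= detected_prob m d h (law z) w.
Proof.
have [/andP[a0 a1] /andP[b0 b1] /andP[p0 p1] /andP[r0 r1] _] := hm.
elim: w h z => //= -[x i] w IH h z [z1 z2].
have /andP[d0 d1] := hd h.
rewrite !mulr_ge0 //; [by case: (x)|by case: (i); rewrite /= ?subr_ge0|].
have k0 : 0 <= miss m i x by rewrite /miss; case: eqP => // _; case: (i).
have k1 : 0 <= 1 - miss m i x.
  by rewrite subr_ge0 /miss; case: eqP => // _; case: (i); rewrite ltW.
case: w IH => // e w IH; rewrite mulr_ge0 //.
have := IH (rcons h i) (if x then (stay1 m, 1 - stay1 m) else (1 - stay2 m, stay2 m)).
case: x {k0 k1} => hx.
  by apply: hx; split; rewrite /= ?subr_ge0.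
have E : move m false = law (1 - stay2 m, stay2 m).
  by apply: funext => -[]; rewrite //= /move /bernoulli_site /= opprB addrC subrK.
by rewrite E; apply: hx; split; rewrite /= ?subr_ge0.
Qed.

Lemma detected_prob_law h z w :
  detected_prob m d h (law z) w =
  z.1 * detected_prob m d h (law (1, 0)) w + z.2 * detected_prob m d h (law (0, 1)) w.
Proof.
case: w => [|[x i] w]; first by rewrite /= !mulr0 addr0.
by case: x; rewrite /=; ring.
Qed.

Lemma detected_prob_move h x w :
  detected_prob m d h (move m x) w =
  detected_prob m d h (law (drift m (if x then (1, 0) else (0, 1)))) w.
Proof.
congr detected_prob; apply: funext => y.
by case: x; case: y; rewrite /move /bernoulli_site /drift /=; ring.
Qed.

(** Summing over the target's site turns the first epoch into a linear step of
    the unnormalised belief. *)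
Lemma detected_prob_cons h z i w :
  detected_prob m d h (law z) ((true, i) :: w) +
    detected_prob m d h (law z) ((false, i) :: w) =
  bernoulli_site (d h) i *
    (if w is [::] then mass z - mass (step m i z)
     else detected_prob m d (rcons h i) (law (step m i z)) w).
Proof.
rewrite /step mass_drift.
case: w => [|e w]; first by case: i; rewrite /= /miss /mass /=; ring.
rewrite [X in X + _](_ : _ = z.1 * bernoulli_site (d h) i *
  (miss m i true * detected_prob m d (rcons h i) (move m true) (e :: w))) //.
rewrite [X in _ + X](_ : _ = z.2 * bernoulli_site (d h) i *
  (miss m i false * detected_prob m d (rcons h i) (move m false) (e :: w))) //.
rewrite !detected_prob_move (detected_prob_law _ (drift m _)) (detected_prob_law _
  (drift m (0, 1))).
rewrite (detected_prob_law _ (drift m (survive m i z))).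
by case: i; rewrite /miss /drift /survive /=; ring.
Qed.

(** First-step analysis: the path that ends at the first epoch is separated
    because [detected_prob] treats it apart, and the empty path has weight 0. *)
Lemma sum_paths_cons n h z (g : detected_path -> R) (g' : bool -> detected_path -> R) :
  (forall x i w, g ((x, i) :: w) = g' i w) ->
  \sum_(w <- paths n.+1) detected_prob m d h (law z) w * g w =
  mean
   ((mass z - mass (step m true z)) * g' true [::] + \sum_(w <- paths n)
      detected_prob m d (rcons h true) (law (step m true z)) w * g' true w)
   ((mass z - mass (step m false z)) * g' false [::] + \sum_(w <- paths n)
      detected_prob m d (rcons h false) (law (step m false z)) w * g' false w) h.
Proof.
move=> E; have F i : \sum_(w <- paths n) (if w is [::] then mass z - mass (step m i z)
     else detected_prob m d (rcons h i) (law (step m i z)) w) * g' i w =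
   (mass z - mass (step m i z)) * g' i [::] + \sum_(w <- paths n)
      detected_prob m d (rcons h i) (law (step m i z)) w * g' i w.
  have -> : paths n = [::] :: behead (paths n) by case: (n).
  rewrite !big_cons mul0r add0r; congr (_ + _); apply: eq_big_seq => -[|e w] //.
  by have := uniq_paths n; case: (n) => [|k] //= /andP[/negP].
have G i : \sum_(w <- paths n) detected_prob m d h (law z) ((true, i) :: w) * g
  ((true, i) :: w) +
    \sum_(w <- paths n) detected_prob m d h (law z) ((false, i) :: w) * g ((false, i)
      :: w) =
    bernoulli_site (d h) i * ((mass z - mass (step m i z)) * g' i [::] +
      \sum_(w <- paths n)
      detected_prob m d (rcons h i) (law (step m i z)) w * g' i w).
  rewrite -F mulr_sumr -big_split; apply: eq_bigr => w _ /=.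
  by rewrite !E -mulrDl detected_prob_cons mulrA.
rewrite pathsS big_cons mul0r add0r big_allpairs_dep /epochs !big_cons big_nil.
by rewrite Monoid.mulm1 Monoid.mulmA; exact: (congr2 +%R (G true) (G false)).
Qed.


Lemma mean_same x h : mean x x h = x.
Proof. by rewrite /mean; ring. Qed.

Lemma undetected_ge0 n h z : cone z -> 0 <= undetected n h z.
Proof.
elim: n h z => [|n IH] h z hz; first exact: cone_mass.
rewrite -(mean_same 0 h); apply: le_mean; apply: IH; exact: cone_step.
Qed.

Lemma undetected_le_mass n h z : cone z -> undetected n h z <= mass z.
Proof.
elim: n h z => [|n IH] h z hz //; rewrite -[leRHS](mean_same _ h).
apply: le_mean.
  exact: le_trans (IH _ _ (cone_step hm true hz)) (mass_step hm true hz).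
exact: le_trans (IH _ _ (cone_step hm false hz)) (mass_step hm false hz).
Qed.

Lemma horizon_le_spent n h z : horizon_cost m n z <= spent n h z.
Proof.
elim: n h z => [|n IH] h z //; rewrite -[leLHS](mean_same _ h); apply: le_mean.
  by apply: le_trans (horizonS_le m n true z) _; rewrite lerD2l.
by apply: le_trans (horizonS_le m n false z) _; rewrite lerD2l.
Qed.

Lemma detected_mass n h z :
  \sum_(w <- paths n) detected_prob m d h (law z) w = mass z - undetected n h z.
Proof.
have E k h' z' : \sum_(w <- paths k) detected_prob m d h' (law z') w * 1 =
                 \sum_(w <- paths k) detected_prob m d h' (law z') w.
  by apply: eq_bigr => w _; rewrite mulr1.
elim: n h z => [|n IH] h z; first by rewrite big_seq1 /= subrr.
rewrite -E (@sum_paths_cons n h z (fun=> 1) (fun _ _ => 1)) // !E !IH.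
by rewrite /mean /=; rewrite /mean; ring.
Qed.

Definition detected_cost n h z : R :=
  \sum_(w <- paths n) detected_prob m d h (law z) w * path_search_cost w.

Lemma detected_costS n h z : detected_cost n.+1 h z =
  mean
   (cost1 m * (mass z - undetected n (rcons h true) (step m true z)) +
     detected_cost n (rcons h true) (step m true z))
   (cost2 m * (mass z - undetected n (rcons h false) (step m false z)) +
     detected_cost n (rcons h false) (step m false z)) h.
Proof.
rewrite /detected_cost (@sum_paths_cons n h z _
  (fun i w => search_cost m i + path_search_cost w)); last first.
  by move=> x i w; rewrite /path_search_cost big_cons.
have F i : \sum_(w <- paths n) detected_prob m d (rcons h i) (law (step m i z)) w *
      (search_cost m i + path_search_cost w) =
    (mass (step m i z) - undetected n (rcons h i) (step m i z)) * search_cost m i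
    + detected_cost n (rcons h i) (step m i z).
  rewrite -detected_mass mulr_suml -big_split; apply: eq_bigr => w _ /=.
  by rewrite mulrDr.
by rewrite !F /path_search_cost !big_nil /mean /detected_cost /=; ring.
Qed.

Lemma detected_cost_ge0 n h z : cone z -> 0 <= detected_cost n h z.
Proof.
move=> hz; apply: sumr_ge0 => w _; rewrite mulr_ge0 ?detected_prob_ge0 //.
by apply: sumr_ge0 => e _; rewrite ltW // cost_gt0.
Qed.

(** Paths that are still undetected have also paid for their searches. *)
Lemma detected_cost_le_spent n h z : cone z -> detected_cost n h z <= spent n h z.
Proof.
have [_ _ _ _ [C1 C2]] := hm.
elim: n h z => [|n IH] h z hz; first by rewrite /detected_cost big_seq1 /= mul0r.
rewrite detected_costS; apply: le_mean; apply: lerD; try exact/IH/cone_step.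
  by rewrite ler_pM2l // gerBl undetected_ge0 //; exact: cone_step.
by rewrite ler_pM2l // gerBl undetected_ge0 //; exact: cone_step.
Qed.

(** On paths detected within [k] epochs the first [n] epochs cost no more than
    the whole path; on the others they cost at most [n] times a constant. *)
Lemma spent_le_detected_cost n k h z : cone z -> (n <= k)%N ->
  spent n h z <= detected_cost k h z + n%:R * (cost1 m + cost2 m) * undetected k h z.
Proof.
have [_ _ _ _ [C1 C2]] := hm.
elim: n k h z => [|n IH] k h z hz nk.
  by rewrite /= mul0r mul0r addr0 detected_cost_ge0.
case: k nk => // k nk; rewrite detected_costS.
have F i : search_cost m i * mass z + spent n (rcons h i) (step m i z) <=
    search_cost m i * (mass z - undetected k (rcons h i) (step m i z)) +
    detected_cost k (rcons h i) (step m i z) +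
    n.+1%:R * (cost1 m + cost2 m) * undetected k (rcons h i) (step m i z).
  have h1 := IH k (rcons h i) _ (cone_step hm i hz) nk.
  have u0 := undetected_ge0 k (rcons h i) (cone_step hm i hz).
  have : search_cost m i * undetected k (rcons h i) (step m i z) <=
     (cost1 m + cost2 m) * undetected k (rcons h i) (step m i z).
    by rewrite ler_wpM2r //; case: (i); rewrite /= ?lerDl ?lerDr ltW.
  by move: h1; rewrite -natr1; lra.
apply: le_trans (le_mean h (F true) (F false)) _.
by rewrite /mean /= /mean le_eqVlt; apply/orP; left; apply/eqP; ring.
Qed.

Lemma undetected_le_spent n h z : cone z ->
  n%:R * (least_cost m * undetected n h z) <= spent n h z.
Proof.
elim: n h z => [|n IH] h z hz; first by rewrite mul0r.
have F i : n.+1%:R * (least_cost m * undetected n (rcons h i) (step m i z)) <=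
    search_cost m i * mass z + spent n (rcons h i) (step m i z).
  rewrite -natr1 mulrDl mul1r addrC lerD ?IH //; last exact: cone_step.
  apply: ler_pM; rewrite ?least_cost_le ?(ltW (least_cost_gt0 hm)) //.
    exact/undetected_ge0/cone_step.
  exact: le_trans (undetected_le_mass _ _ (cone_step hm i hz)) (mass_step hm i hz).
apply: le_trans (le_mean h (F true) (F false)).
by rewrite /mean /= /mean le_eqVlt; apply/orP; left; apply/eqP; ring.
Qed.

End Run.

(** * Optimality of the threshold policy *)

Lemma archi_small {R : realType} (e B : R) : 0 < e -> exists n, forall x : R,
  (forall k, (n <= k)%N -> k%:R * x <= B -> x <= e).
Proof.
move=> e0; have /archi_boundP : 0 <= `|B| / e by rewrite divr_ge0 // ltW.
set n := Num.bound _ => h; exists n => x k nk hx; rewrite leNgt; apply/negP => ex.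
have : B < k%:R * x.
  apply: le_lt_trans (ler_norm B) _; rewrite ltr_pdivrMr // in h.
  apply: lt_le_trans h _; apply: ler_pM => //; rewrite ?ler_nat // ltW //.
by rewrite ltNge hx.
Qed.

Section Expected.
Context {R : realType}.
Variable m : search_model R.
Hypothesis hm : admissible m.

Section Policy.
Variables (pi : policy R) (p : R).
Hypothesis hpi : is_policy pi.
Hypothesis hp : 0 <= p <= 1.

Local Notation z0 := (p, 1 - p).
Local Notation d := (pi p).

Lemma rule01 h : 0 <= d h <= 1. Proof. exact: hpi. Qed.

Lemma cone_belief : cone z0.
Proof. by case/andP: hp => ? ?; split; rewrite //= subr_ge0. Qed.

Lemma mass_belief : mass z0 = 1. Proof. by rewrite /mass /= addrC subrK. Qed.

Let term (w : sample_path) : \bar R := (path_prob m pi p w * path_cost m w)%E.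
Let detection : \bar R := (\esum_(w in [set: detected_path])
  (detected_prob m d [::] (law z0) w)%:E)%E.

Lemma sum_paths_detection n :
  (\sum_(w <- paths n) (detected_prob m d [::] (law z0) w)%:E =
   (1 - undetected m d n [::] z0)%:E)%E.
Proof. by rewrite sumEFin detected_mass mass_belief. Qed.

Lemma detection_le1 : (detection <= 1)%E.
Proof.
apply: (esum_le_exhaustion (l := paths)) => [w|n|n w|w|n].
- by rewrite lee_fin detected_prob_ge0 //; [exact: rule01|exact: cone_belief].
- exact: uniq_paths.
- by rewrite !mem_paths => /leqW.
- by exists (size w); rewrite mem_paths.
- rewrite sum_paths_detection lee_fin gerBl.
  by apply: undetected_ge0 => //; [exact: rule01|exact: cone_belief].
Qed.

Lemma sum_some_paths n : (\sum_(w <- [seq Some w | w <- paths n]) term w =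
  (detected_cost m d n [::] z0)%:E)%E.
Proof. by rewrite big_map -sumEFin; apply: eq_bigr => w _; rewrite EFinM. Qed.

Lemma detected_cost_le_expected n :
  ((detected_cost m d n [::] z0)%:E <= expected_cost m pi p)%E.
Proof.
rewrite -sum_some_paths; apply: big_seq_le_esum.
by rewrite (map_inj_uniq Some_inj) uniq_paths.
Qed.

(** If detection is not almost sure, the expected cost is infinite.  Otherwise
    the undetected mass tends to 0 and the error in [spent_le_detected_cost]
    vanishes. *)
Lemma spent_le_expected n : ((spent m d n [::] z0)%:E <= expected_cost m pi p)%E.
Proof.
have [lt1|ge1] := ltP detection 1%E.
  have : (\sum_(w <- [:: None]) term w <=
    expected_cost m pi p)%E by exact: big_seq_le_esum.
  rewrite big_seq1 /term /= -/detection gt0_muley ?sube_gt0 // leye_eq => /eqP ->.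
  exact: leey.
apply/lee_addgt0Pr => e e0.
have [_ _ _ _ [C1 C2]] := hm.
pose L := n%:R * (cost1 m + cost2 m).
have L0 : 0 <= L by rewrite mulr_ge0 // addr_ge0 // ltW.
have e1 : 0 < e / (L + 1) by rewrite divr_gt0 // ltr_wpDl.
have [k hk] : exists k, undetected m d (k + n) [::] z0 <= e / (L + 1).
  apply/not_existsP => H; move: ge1; rewrite leNgt => /negP; apply.
  apply: (@le_lt_trans _ _ (1 - e / (L + 1))%:E); last by rewrite lte_fin ltrBlDr ltrDl.
  apply: (esum_le_exhaustion (l := fun k => paths (k + n))) => [w|k|k w|w|k].
  - by rewrite lee_fin detected_prob_ge0 //; [exact: rule01|exact: cone_belief].
  - exact: uniq_paths.
  - by rewrite !mem_paths addSn => /leqW.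
  - by exists (size w); rewrite mem_paths leq_addr.
  - rewrite sum_paths_detection lee_fin lerD2l lerN2.
    by have /negP := H k; rewrite -ltNge => /ltW.
have h1 := spent_le_detected_cost hm rule01 [::] cone_belief (leq_addl k n).
apply: le_trans (_ : (detected_cost m d (k + n) [::] z0 + e)%:E <= _)%E.
  rewrite lee_fin; apply: le_trans h1 _; rewrite lerD2l -/L.
  apply: le_trans (ler_wpM2l L0 hk) _.
  rewrite mulrA ler_pdivrMr ?ltr_wpDl //; lra.
by rewrite EFinD leeD2r // detected_cost_le_expected.
Qed.

Lemma opt_cost_le_expected : ((opt_cost m z0)%:E <= expected_cost m pi p)%E.
Proof.
case E : (expected_cost m pi p) => [r| |]; last 2 first.
- exact: leey.
- by have := spent_le_expected 0; rewrite E.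
rewrite lee_fin; apply: opt_cost_le => n.
apply: le_trans (horizon_le_spent m rule01 n [::] z0) _.
by rewrite -lee_fin -E spent_le_expected.
Qed.

(** Bounded costs force the undetected mass to 0 by [undetected_le_spent], so the
    infinite cost of never detecting has weight 0. *)
Lemma expected_le_bound (B : R) : (forall n, spent m d n [::] z0 <= B) ->
  (expected_cost m pi p <= B%:E)%E.
Proof.
move=> H; have u0 n : 0 <= undetected m d n [::] z0.
  by apply: undetected_ge0 => //; [exact: rule01|exact: cone_belief].
have detE : detection = 1%E.
  apply/eqP; rewrite eq_le detection_le1 /=; apply/lee_addgt0Pr => e e0.
  have [n hn] := archi_small (B / least_cost m) e0.
  have un : undetected m d n [::] z0 <= e.
    apply: (hn _ n (leqnn n)).
    rewrite ler_pdivlMr ?least_cost_gt0 // -mulrA [_ * least_cost m]mulrC.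
    exact: le_trans (undetected_le_spent hm rule01 n [::] cone_belief) (H n).
  apply: le_trans (_ : (1 - undetected m d n [::] z0)%:E + e%:E <= _)%E.
    by rewrite -EFinD lee_fin; lra.
  by rewrite leeD2r // -sum_paths_detection big_seq_le_esum // uniq_paths.
have none0 : term None = 0%E by rewrite /term /= -/detection detE subee // mul0e.
have memE n w : (Some w \in None :: [seq Some w | w <- paths n]) = (size w <= n)%N.
  by rewrite in_cons (mem_map Some_inj) mem_paths.
apply: (esum_le_exhaustion (l := fun n => None :: [seq Some w | w <- paths n]))
  => [w|n|n w|w|n].
- case: w => [w|]; last by rewrite -/(term None) none0.
  rewrite /= mule_ge0 // lee_fin.
    exact: (detected_prob_ge0 hm rule01 [::] w cone_belief).
  by apply: sumr_ge0 => e _; rewrite ltW // cost_gt0.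
- rewrite cons_uniq (map_inj_uniq Some_inj) uniq_paths andbT.
  by apply/mapP => -[].
- by case: w => [w|]; rewrite ?memE ?in_cons // => /leqW.
- by case: w => [w|]; [exists (size w); rewrite memE|exists 0%N; rewrite in_cons].
- rewrite big_cons -/(term None) none0 add0e sum_some_paths lee_fin.
  exact: le_trans (detected_cost_le_spent hm rule01 n [::] cone_belief) (H n).
Qed.

End Policy.

Lemma posterior_rcons (p : R) h i :
  posterior m p (rcons h i) = next_belief m i (posterior m p h).
Proof. by elim: h p => //= j h IH p; rewrite IH. Qed.

Variable q : R.

(** At [q] itself either site may be required for optimality, so the better one
    is chosen there. *)
Definition threshold_rule : policy R := fun p h =>
  let b := posterior m p h in
  if b < q then 0 else if q < b then 1
  else if opt_cost_after m true (q, 1 - q) <=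
    opt_cost_after m false (q, 1 - q) then 1 else 0.

Lemma threshold_rule01 p h : 0 <= threshold_rule p h <= 1.
Proof. by rewrite /threshold_rule; do 3?case: ifP => _; rewrite ?lexx ?ler01. Qed.

Hypothesis q01 : 0 <= q <= 1.
Hypothesis hq : forall z, cone z ->
    (z.1 < q * mass z -> opt_cost_after m false z <= opt_cost_after m true z) /\
    (q * mass z < z.1 -> opt_cost_after m true z <= opt_cost_after m false z).

(** The posterior of the model is the normalisation of the unnormalised belief,
    as long as that belief has positive mass. *)
Definition tracks (p : R) h (z : R * R) : Prop :=
  cone z /\ (0 < mass z -> z.1 = mass z * posterior m p h).

Lemma tracks_step p h i z : tracks p h z -> tracks p (rcons h i) (step m i z).
Proof.
move=> [hz E]; have hs := cone_step hm i hz; split=> // M.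
have M0 : 0 < mass z := lt_le_trans M (mass_step hm i hz).
have E1 := E M0; set b := posterior m p h in E1.
have E2 : z.2 = mass z * (1 - b) by rewrite mulrBr mulr1 -E1 /mass; ring.
rewrite posterior_rcons -/b.
have F : mass (step m i z) = mass z * fail_prob m i b.
  rewrite /step mass_drift; case: i {hs M}; rewrite /mass /= E1 E2 /mass /=; ring.
have F0 : fail_prob m i b != 0.
  by apply/eqP => F0; move: M; rewrite F F0 mulr0 ltxx.
rewrite F /next_belief -mulrA [fail_prob _ _ _ * _]mulrC divfK //.
by case: i {hs M F F0}; rewrite /step /drift /= E1 E2; ring.
Qed.

(** The rule always makes an optimal search, so Bellman's equation is an equality
    along it, up to the nonnegative cost after the last epoch. *)
Lemma spent_threshold_le n p h z : tracks p h z ->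
  spent m (threshold_rule p) n h z <= opt_cost m z.
Proof.
elim: n h z => [|n IH] h z hz; first exact/opt_cost_ge0/hz.1.
have [hz0 E] := hz.
have F i : search_cost m i * mass z +
  spent m (threshold_rule p) n (rcons h i) (step m i z)
    <= opt_cost_after m i z by rewrite lerD2l; apply/IH/tracks_step.
have opt (i : bool) : opt_cost_after m i z <= opt_cost_after m (~~ i) z ->
  opt_cost_after m i z <= opt_cost m z.
  by move=> le; case: (opt_cost_after_or hm hz0) => ->; case: i le.
have best1 : opt_cost_after m true z <= opt_cost_after m false z ->
    search_cost m true * mass z +
      spent m (threshold_rule p) n (rcons h true) (step m true z)
    <= opt_cost m z by move=> le; apply: le_trans (F true) (opt true le).
have best0 : opt_cost_after m false z <= opt_cost_after m true z ->
    search_cost m false * mass z +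
      spent m (threshold_rule p) n (rcons h false) (step m false z)
    <= opt_cost m z by move=> le; apply: le_trans (F false) (opt false le).
rewrite [spent _ _ _ _ _]/=.
have [M0|M0] := ltP 0 (mass z); last first.
  have H i : opt_cost_after m i z <= opt_cost m z.
    apply: le_trans (opt_cost_ge0 hm hz0).
    have M : mass z = 0 by apply/eqP; rewrite eq_le M0 cone_mass.
    rewrite /opt_cost_after M mulr0 add0r;
      apply: le_trans (opt_cost_le_bound hm (cone_step hm i hz0)) _.
    by rewrite pmulr_rle0 ?cost_bound_gt0 // -M mass_step.
  rewrite -(mean_same (threshold_rule p) (opt_cost m z) h); apply: le_mean.
  - by move=> h'; exact: threshold_rule01.
  - exact: le_trans (F true) (H true).
  - exact: le_trans (F false) (H false).
have [left right] := hq hz0; have E1 := E M0.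
rewrite /mean [threshold_rule p h]/threshold_rule; set b := posterior m p h in E1 *.
case: (ltgtP b q) => [lt|lt|bq].
- rewrite mul0r add0r subr0 mul1r; apply: best0; apply: left.
  by rewrite E1 mulrC ltr_pM2r.
- rewrite mul1r subrr mul0r addr0; apply: best1; apply: right.
  by rewrite E1 mulrC ltr_pM2l.
have Ez : z = (mass z * q, mass z * (1 - q)).
  rewrite -bq -E1 mulrBr mulr1 -E1 [LHS]surjective_pairing; congr (_, _).
  by rewrite /mass; ring.
have T i : opt_cost_after m i z = mass z * opt_cost_after m i (q, 1 - q).
  rewrite -opt_cost_afterZ ?(ltW M0) //= -?Ez //.
  by case/andP: q01 => ? ?; split; rewrite //= subr_ge0.
case: ifPn => [le|]; last rewrite -ltNge => /ltW le.
  by rewrite mul1r subrr mul0r addr0; apply: best1; rewrite !T ler_pM2l.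
by rewrite mul0r add0r subr0 mul1r; apply: best0; rewrite !T ler_pM2l.
Qed.

End Expected.

Theorem theorem1p1 (R : realType) (a b alpha1 alpha2 C1 C2 : R)
    (ha : 0 <= a <= 1) (hb : 0 <= b <= 1)
    (halpha1 : 0 <= alpha1 < 1) (halpha2 : 0 <= alpha2 < 1)
    (hC1 : 0 < C1) (hC2 : 0 < C2) :
  let m := SearchModel a b alpha1 alpha2 C1 C2 in
  exists (pstar : R) (pi : policy R),
    [/\ 0 <= pstar <= 1, optimal m pi & threshold_policy m pstar pi].
Proof.
move=> m; have hm : admissible m by split.
have [q q01 hq] := admissible_threshold hm.
exists q, (threshold_rule m q); split=> //; last first.
  move=> p h _ _; rewrite /threshold_rule; case: ltgtP => _; split=> //.
have hpi : is_policy (threshold_rule m q) by move=> p h _; exact: threshold_rule01.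
split=> // p hp; apply/eqP; rewrite eq_le; apply/andP; split; last first.
  by apply: ereal_inf_lbound; exists (threshold_rule m q).
apply: (@le_trans _ _ (opt_cost m (p, 1 - p))%:E); last first.
  by apply: le_ereal_inf_tmp => _ [pi' hpi' <-]; exact: opt_cost_le_expected.
apply: expected_le_bound => // n; apply: spent_threshold_le => //.
split; first exact: cone_belief.
by rewrite mass_belief mul1r.
Qed.
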